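(* Let $T\in\mathcal{B}(H)$ be invertible with polar decomposition $T=U|T|$. Assume that one of the following conditions is satisfied: (i) $\mathfrak{m}$ is a weighted operator arithmetic mean (i.e. its representing function is $f_\lambda(x)=1-\lambda+\lambda x$ for some $\lambda\in[0,1]$); (ii) $\mathfrak{m}$ is an (arbitrary) operator mean and $T$ is binormal. Then the polar decomposition of the induced Aluthge transformation of $T$ with respect to $\mathfrak{m}$ is $$\Delta_{\mathfrak{m}}(T)=U\,\mathfrak{m}(U^{*}|T|U,\,|T|).$$ Hence $|\Delta_{\mathfrak{m}}(T)|=\mathfrak{m}(U^{*}|T|U,|T|)$.
   Context: $H$ is a complex Hilbert space, $\mathcal{B}(H)$ the bounded linear operators on $H$, $\mathcal{B}(H)_{++}$ the positive invertible ones, $|T|=(T^*T)^{1/2}$. If $T$ is invertible, the factor $U$ in its polar decomposition $T=U|T|$ is unitary. Operator mean: an operator mean $\mathfrak{m}=\mathfrak{m}_f$ corresponds to a representing function $f:(0,\infty)\to(0,\infty)$, which is operator monotone with $f(1)=1$; for $A,B\in\mathcal{B}(H)_{++}$, $\mathfrak{m}_f(A,B)=A^{1/2}f(A^{-1/2}BA^{-1/2})A^{1/2}$. Induced Aluthge transformation: for invertible $T=U|T|$ with spectral decomposition $|T|=\int_{\sigma(|T|)}s\,dE_s$, define $\Delta_{\mathfrak{m}_f}(T)=\Delta_f(T):=\int_{\sigma(|T|)}\int_{\sigma(|T|)} s f(t/s)\,dE_s\,U\,dE_t$ (double operator integral). Concretely (known fact), if $\mu$ is a probability measure on $[0,1]$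 with $f(x)=\int_0^1[1-\lambda+\lambda x^{-1}]^{-1}d\mu(\lambda)$ for $x>0$ (such $\mu$ exists), then $\Delta_f(T)=\int_0^1\int_0^\infty e^{-(1-\lambda)s|T|^{-1}}\,U\,e^{-\lambda s|T|^{-1}}\,ds\,d\mu(\lambda)$. For $f_\lambda(x)=1-\lambda+\lambda x$ this is $\Delta_{f_\lambda}(T)=(1-\lambda)|T|U+\lambda U|T|$. $T$ is binormal if $|T|\,|T^*|=|T^*|\,|T|$. *)

(* Defs.v *)
From HB Require Import structures.
From mathcomp Require Import all_boot all_order all_algebra.
From mathcomp Require Import sesquilinear.
From mathcomp Require Import complex.
From mathcomp Require Import boolp classical_sets reals topology normedtype.

Set Implicit Arguments.
Unset Strict Implicit.
Unset Printing Implicit Defensive.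

Import Order.TTheory GRing.Theory Num.Theory Num.Def.
Import numFieldNormedType.Exports.

Local Open Scope classical_set_scope.
Local Open Scope ring_scope.
Local Open Scope complex_scope.

(* The inner product is linear in its first argument. *)
HB.mixin Record CompleteNormedModule_isHilbert (R : realType) H
    of CompleteNormedModule R[i] H := {
  hdot : {dot H for conjC} ;
  hdot_norm : forall x : H, `|x| ^+ 2 = hdot x x
}.

#[short(type="hilbertType")]
HB.structure Definition Hilbert (R : realType) :=
  {H of CompleteNormedModule R[i] H & CompleteNormedModule_isHilbert R H}.

Section Operators.
Context {R : realType} {H : hilbertType R}.
Implicit Types (S T U A B P : H -> H).

Definition op0 : H -> H := fun=> 0.

Definition bounded_op T : Prop :=
  linear T /\ exists M : R, forall x, `|T x| <= M%:C * `|x|.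

(* Each condition under [xget] in this file is satisfied by at most one
   operator; [op0] is a junk value. *)
Definition adjoint T : H -> H :=
  xget op0 [set S | bounded_op S /\ forall x y, hdot (T x) y = hdot x (S y)].

Definition inverse_of T S : Prop :=
  [/\ bounded_op S, S \o T = id & T \o S = id].

Definition invertible_op T : Prop := bounded_op T /\ exists S, inverse_of T S.

Definition inv_op T : H -> H := xget op0 [set S | inverse_of T S].

(* The order of [R[i]] makes these imply that the quadratic forms, resp. their
   difference, are real. *)
Definition positive_op A : Prop := bounded_op A /\ forall x, 0 <= hdot (A x) x.

Definition op_le A B : Prop := forall x, hdot (A x) x <= hdot (B x) x.

Definition positive_invertible A : Prop := positive_op A /\ invertible_op A.

Definition sqrt_op A : H -> H :=
  xget op0 [set S | positive_op S /\ S \o S = A].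

Definition abs_op T : H -> H := sqrt_op (adjoint T \o T).

Definition partial_isometry U : Prop :=
  bounded_op U /\
  forall x, (forall y, U y = 0 -> hdot x y = 0) -> `|U x| = `|x|.

Definition polar_decomposition T U P : Prop :=
  [/\ T = U \o P, P = abs_op T, partial_isometry U &
      forall x, (U x = 0) <-> (T x = 0)].

Definition binormal T : Prop :=
  abs_op T \o abs_op (adjoint T) = abs_op (adjoint T) \o abs_op T.

Definition projection_op P : Prop :=
  [/\ bounded_op P, P \o P = P & forall x y, hdot (P x) y = hdot x (P y)].

(* [E s] stands for the spectral projection of the half-line ]-oo, s]. *)
Definition spectral_family (E : R -> H -> H) : Prop :=
  [/\ forall s, projection_op (E s),
      forall s t, s <= t -> op_le (E s) (E t),
      forall s v, E t v @[t --> s^'+] --> E s v &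
      exists a b, (forall s, s < a -> E s = op0) /\
                  (forall s, b <= s -> E s = id)].

(* Nodes [x 0 <= ... <= x n], tags [xi i] in [[x i, x i.+1]], mesh [< d]; the
   interval ]x 0, x n] carries the whole spectral measure of [E]. *)
Definition tagged_partition (E : R -> H -> H) (d : R) (n : nat)
    (x xi : nat -> R) : Prop :=
  [/\ E (x 0%N) = op0, E (x n) = id &
      forall i, (i < n)%N -> [/\ x i <= xi i, xi i <= x i.+1 & x i.+1 - x i < d]].

Definition increment (E : R -> H -> H) (x : nat -> R) (i : nat) : H -> H :=
  fun v => E (x i.+1) v - E (x i) v.

(* B = \int f(s) dE_s, as a Riemann-Stieltjes integral converging in operator
   norm. *)
Definition spectral_integral (f : R -> R) (E : R -> H -> H) B : Prop :=
  forall e : R, 0 < e -> exists2 d : R, 0 < d &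
    forall n x xi, tagged_partition E d n x xi ->
    forall v : H,
      `|\sum_(i < n) (f (xi i))%:C *: increment E x i v - B v| <= e%:C * `|v|.

(* D = \int \int phi(s, t) dE_s X dF_t, likewise. If phi is an integral
   \int a_w(s) b_w(t) dw with a_w, b_w continuous and \int |a_w| |b_w| dw
   finite (sup norms), as is s f(t / s) for f operator monotone, the sums do
   converge in norm, to \int a_w(A) X b_w(B) dw, where A = \int s dE_s and
   B = \int t dF_t. *)
Definition double_operator_integral (phi : R -> R -> R) (E : R -> H -> H)
    (X : H -> H) (F : R -> H -> H) (D : H -> H) : Prop :=
  forall e : R, 0 < e -> exists2 d : R, 0 < d &
    forall m x xi, tagged_partition E d m x xi ->
    forall n y eta, tagged_partition F d n y eta ->
    forall v : H,
      `|\sum_(i < m) \sum_(j < n)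
          (phi (xi i) (eta j))%:C *: increment E x i (X (increment F y j v))
        - D v| <= e%:C * `|v|.

Definition spectral_resolution A (E : R -> H -> H) : Prop :=
  spectral_family E /\ spectral_integral id E A.

(* f(A), for A self-adjoint and f continuous on a neighbourhood of the
   spectrum of A. *)
Definition fun_op (f : R -> R) A : H -> H :=
  xget op0 [set B | exists E, spectral_resolution A E /\
                              spectral_integral f E B].

Definition op_mean (f : R -> R) A B : H -> H :=
  let A12 := sqrt_op A in
  A12 \o fun_op f (inv_op A12 \o B \o inv_op A12) \o A12.

(* [U] and [E] are determined by [T]. *)
Definition is_aluthge (f : R -> R) T (D : H -> H) : Prop :=
  exists U E, [/\ polar_decomposition T U (abs_op T),
                  spectral_resolution (abs_op T) E &
                  double_operator_integral (fun s t => s * f (t / s)) E U E D].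

Definition aluthge (f : R -> R) T : H -> H := xget op0 [set D | is_aluthge f T D].

End Operators.

(* Functions ]0, +oo[ -> ]0, +oo[ are total functions whose values outside
   ]0, +oo[ are ignored. *)
Definition operator_monotone {R : realType} (f : R -> R) : Prop :=
  (forall x : R, 0 < x -> {for x, continuous f}) /\
  forall (K : hilbertType R) (A B : K -> K),
    positive_invertible A -> positive_invertible B ->
    op_le A B -> op_le (fun_op f A) (fun_op f B).

Definition representing_function {R : realType} (f : R -> R) : Prop :=
  [/\ forall x, 0 < x -> 0 < f x, operator_monotone f & f 1 = 1].

Definition arithmetic_representing {R : realType} (f : R -> R) : Prop :=
  exists2 l : R, 0 <= l <= 1 & forall x, 0 < x -> f x = 1 - l + l * x.

(* Main.v *)
(* Write [P = |T|] and [A = U^* P U]. The transform is [D = \int\int s f(t / s) dE_s U dE_t],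
   and [U^* D] is the same double integral with the resolution [U^* E_s U] of [A]
   on the left. If [f] is affine, both integrals split and everything reduces to
   [(1 - l) A + l P]. If [T] is binormal, [A] and [P] commute, hence so do
   their spectral projections and those [dG_r] of [C = A^(-1/2) P A^(-1/2)]. On
   the range of [(U^* dE_s U) dE_t dG_r] the operators [A], [P] and [C] are close
   to the scalars [s], [t] and [r], and [P = C A] forces [t / s] to be close to
   [r]; by uniform continuity of [f], the orthogonal sums for [U^* D] and for
   [A f(C)] are close in norm, and [A f(C) = A^(1/2) f(C) A^(1/2)] is the mean.
   The polar decomposition follows since the mean is positive and injective and
   positive square roots are unique.

   The spectral theorem comes from the projections [E_s] onto the kernel of the
   positive part of [A - s]. An arbitrary spectral family of [A] commutes with
   the self-adjoint operators commuting with [A], because powers of [A - a] grow at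
   different rates on the ranges of [E_s] and [1 - E_t] for [s < t]. *)
Require Import Defs.
From HB Require Import structures.
From mathcomp Require Import all_boot all_order all_algebra.
From mathcomp Require Import sesquilinear complex.
From mathcomp Require Import boolp classical_sets reals topology normedtype sequences.
From mathcomp Require Import derive.
From mathcomp Require Import ring lra.
Set Implicit Arguments.
Unset Strict Implicit.
Unset Printing Implicit Defensive.
Import Order.TTheory GRing.Theory Num.Theory.
Import numFieldNormedType.Exports.
Local Open Scope classical_set_scope.
Local Open Scope ring_scope.
Local Open Scope complex_scope.

(** * Real inner product and norm *)

(** The operators of the statement ([adjoint], [sqrt_op], [inv_op], [fun_op], [aluthge]) are choices
    made by [xget]: each becomes usable only once a witness is exhibited, and uniqueness then
    identifies it. For [fun_op] and [aluthge] the choice comes with an unknown spectral family,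
    which is why commutation and estimates are proved for arbitrary families and not just for the
    constructed one. Adjoints do not come from a representation theorem: the unitary factor is
    inverted by [W = P T^-1], and each adjoint that occurs is then an explicit product. Square roots
    and spectral projections cannot use a functional calculus either; they are strong limits of
    iterations. The norm estimates rest on Pythagoras: in a sum over orthogonal pieces the worst
    piece decides, however fine the partition, and two sums are compared on a common refinement by
    commuting projections. Without binormality the projections need not commute, so the affine case
    is settled algebraically. *)

Section RealInnerProduct.
Context {R : realType} {H : hilbertType R}.
Implicit Types (x y z w : H) (a : R) (k : R[i]).

(** The real part turns vector identities into [ring] and [lra] goals over [R]; [Im_hdot] recovers
    the imaginary part. *)
Definition ip x y : R := complex.Re (hdot x y).
Definition nrm x : R := complex.Re `|x|.

Lemma normrE_nrm x : `|x| = (nrm x)%:C.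
Proof. by rewrite /nrm RRe_real // ger0_real. Qed.

Lemma ReD (u v : R[i]) : complex.Re (u + v) = complex.Re u + complex.Re v. Proof. by case: u v => [? ?] [? ?]. Qed.
Lemma ReN (u : R[i]) : complex.Re (- u) = - complex.Re u. Proof. by case: u. Qed.
Lemma ReM (u v : R[i]) : complex.Re (u * v) = complex.Re u * complex.Re v - complex.Im u * complex.Im v.
Proof. by case: u v => [? ?] [? ?]. Qed.

Lemma hdotC x y : hdot x y = conjc (hdot y x).
Proof. by rewrite hermC expr0 mul1r. Qed.

Lemma ipC x y : ip x y = ip y x.
Proof. by rewrite /ip hdotC; case: (hdot y x). Qed.

Lemma ipDl x y z : ip (x + y) z = ip x z + ip y z.
Proof. by rewrite /ip linearDl ReD. Qed.

Lemma ipDr x y z : ip z (x + y) = ip z x + ip z y.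
Proof. by rewrite !(ipC z) ipDl. Qed.

Lemma ipNl x z : ip (- x) z = - ip x z.
Proof. by rewrite /ip linearNl ReN. Qed.

Lemma ipNr x z : ip z (- x) = - ip z x.
Proof. by rewrite !(ipC z) ipNl. Qed.

Lemma ip0l z : ip 0 z = 0. Proof. by rewrite /ip linear0l. Qed.
Lemma ip0r z : ip z 0 = 0. Proof. by rewrite ipC ip0l. Qed.

Lemma ipZl a x z : ip (a%:C *: x) z = a * ip x z.
Proof. by rewrite /ip linearZl_LR /= ReM /= mul0r subr0. Qed.

Lemma ipZr a x z : ip z (a%:C *: x) = a * ip z x.
Proof. by rewrite !(ipC z) ipZl. Qed.

Definition ipE := (ipDl, ipDr, ipNl, ipNr, ipZl, ipZr, ip0l, ip0r).

Lemma ip_suml (I : finType) (F : I -> H) z : ip (\sum_i F i) z = \sum_i ip (F i) z.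
Proof. by elim/big_rec2: _ => [|i a b _ <-]; rewrite ?ip0l ?ipDl. Qed.

Lemma ip_sumr (I : finType) (F : I -> H) z : ip z (\sum_i F i) = \sum_i ip z (F i).
Proof. by rewrite ipC ip_suml; apply: eq_bigr => i _; rewrite ipC. Qed.

Lemma nrm_ge0 x : 0 <= nrm x.
Proof. by rewrite -ler0c -normrE_nrm. Qed.

Lemma nrm_sqr x : nrm x ^+ 2 = ip x x.
Proof.
have := hdot_norm x; rewrite /ip => <-.
by rewrite normrE_nrm -rmorphXn.
Qed.

Lemma ip_ge0 x : 0 <= ip x x. Proof. by rewrite -nrm_sqr sqr_ge0. Qed.

Lemma nrmZ k x : nrm (k *: x) = complex.Re `|k| * nrm x.
Proof.
rewrite /nrm normrZ ReM.
have /ger0_Im -> : 0 <= `|k| by [].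
by rewrite mul0r subr0.
Qed.

Lemma nrmZr a x : nrm (a%:C *: x) = `|a| * nrm x.
Proof. by rewrite nrmZ normc_def /= expr0n /= addr0 sqrtr_sqr. Qed.

Lemma nrmD x y : nrm (x + y) <= nrm x + nrm y.
Proof. by rewrite -lecR rmorphD /= -!normrE_nrm ler_normD. Qed.

Lemma nrmN x : nrm (- x) = nrm x. Proof. by rewrite /nrm normrN. Qed.
Lemma nrmB x y : nrm (x - y) <= nrm x + nrm y.
Proof. by rewrite (le_trans (nrmD _ _)) // nrmN. Qed.
Lemma nrm_distC x y : nrm (x - y) = nrm (y - x). Proof. by rewrite -nrmN opprB. Qed.
Lemma nrm0 : nrm 0 = 0. Proof. by rewrite /nrm normr0. Qed.

Lemma nrm_dist_triangle y x z : nrm (x - z) <= nrm (x - y) + nrm (y - z).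
Proof. by have := nrmD (x - y) (y - z); rewrite addrA subrK. Qed.

Lemma nrm_eq0 x : nrm x = 0 -> x = 0.
Proof. by move=> h; apply/eqP; rewrite -normr_eq0 normrE_nrm h. Qed.

Lemma ip_eq0 x : ip x x = 0 -> x = 0.
Proof. by rewrite -nrm_sqr => /eqP; rewrite sqrf_eq0 => /eqP/nrm_eq0. Qed.

(* Turns identities between vectors into identities between real numbers. *)
Lemma ip_ext x y : (forall z, ip x z = ip y z) -> x = y.
Proof.
move=> h; apply/subr0_eq/ip_eq0.
by rewrite ipDl ipNl h subrr.
Qed.

Lemma nrm_le a x : 0 <= a -> ip x x <= a ^+ 2 -> nrm x <= a.
Proof. by move=> a0; rewrite -nrm_sqr ler_sqr // nnegrE nrm_ge0. Qed.

Lemma nrm_small_eq0 x : (forall e, 0 < e -> nrm x <= e) -> x = 0.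
Proof.
move=> h; apply/nrm_eq0/eqP; rewrite eq_le nrm_ge0 andbT.
by apply/ler_addgt0Pr => e e0; rewrite add0r h.
Qed.

Lemma ler_addgt0_mulP (a b c : R) : 0 <= c ->
  (forall e, 0 < e -> a <= b + e * c) -> a <= b.
Proof.
move=> c0 h; apply/ler_addgt0Pr => e e0; have c1 : 0 < c + 1 by rewrite ltr_wpDl.
apply: le_trans (h _ (divr_gt0 e0 c1)) _.
by rewrite lerD2l -mulrA ger_pMr // mulrC ler_pdivrMr // mul1r lerDl.
Qed.

Lemma nrm_small_mul_eq0 c x : 0 <= c -> (forall e, 0 < e -> nrm x <= e * c) -> x = 0.
Proof.
move=> c0 h; apply/nrm_eq0/eqP; rewrite eq_le nrm_ge0 andbT.
by apply: ler_addgt0_mulP c0 _ => e e0; rewrite add0r h.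
Qed.

Lemma CauchySchwarz_ip x y : ip x y <= nrm x * nrm y.
Proof.
have [->|x0] := eqVneq x 0; first by rewrite nrm0 ip0l mul0r.
have [->|y0] := eqVneq y 0; first by rewrite nrm0 ip0r mulr0.
have px : 0 < nrm x.
  by rewrite lt_neqAle nrm_ge0 andbT eq_sym; apply: contra x0 => /eqP/nrm_eq0 ->.
have py : 0 < nrm y.
  by rewrite lt_neqAle nrm_ge0 andbT eq_sym; apply: contra y0 => /eqP/nrm_eq0 ->.
(* The square norm of [|y| x - |x| y] is [2 |x| |y| (|x| |y| - ip x y)]. *)
have := ip_ge0 ((nrm y)%:C *: x - (nrm x)%:C *: y).
rewrite !ipE -!nrm_sqr (ipC y x) => h.
have : 0 <= 2 * (nrm x * nrm y) * (nrm x * nrm y - ip x y).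
  by apply: le_trans h _; rewrite le_eqVlt; apply/orP; left; apply/eqP; ring.
by rewrite pmulr_rge0 ?subr_ge0 // !mulr_gt0.
Qed.

Lemma abs_ip x y : `|ip x y| <= nrm x * nrm y.
Proof.
rewrite ler_norml CauchySchwarz_ip andbT lerNl -ipNl.
by rewrite -(nrmN x) CauchySchwarz_ip.
Qed.

End RealInnerProduct.

(** * Sequential limits and bounded operators *)

Section Limits.
Context {R : realType} {H : hilbertType R}.
Implicit Types (x y z w : H) (a : R) (k : R[i]) (u v : nat -> H).

Lemma cvg_nrmP u (l : H) : (u @ \oo --> l) <->
  forall e : R, 0 < e -> exists N, forall n, (N <= n)%N -> nrm (u n - l) <= e.
Proof.
split => [/cvgrPdist_le h e e0|h].
  have e0' : 0 < e%:C by rewrite ltcR.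
  case: (h _ e0') => N _ hN; exists N => n nN.
  by have := hN n nN; rewrite /= normrE_nrm lecR nrm_distC.
apply/cvgrPdist_le => k k0.
have kE : k = (complex.Re k)%:C by rewrite RRe_real // gtr0_real.
have r0 : 0 < complex.Re k by rewrite -ltcR -kE.
have [N hN] := h _ r0.
exists N => // n /= nN.
by rewrite normrE_nrm kE lecR nrm_distC hN.
Qed.

Lemma nrm_complete u :
  (forall e : R, 0 < e -> exists N, forall m n, (N <= m)%N -> (N <= n)%N ->
    nrm (u m - u n) <= e) -> exists l : H, u @ \oo --> l.
Proof.
move=> h; suff : cvg (u @ \oo) by move=> c; exists (lim (u @ \oo)).
apply: cauchy_cvg; apply: cauchy_exP => k k0.
have kE : k = (complex.Re k)%:C by rewrite RRe_real // gtr0_real.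
have r0 : 0 < complex.Re k / 2 by rewrite divr_gt0 // -ltcR -kE.
have [N hN] := h _ r0.
exists (u N); exists N => // n /= nN.
rewrite -ball_normE /ball_ /= normrE_nrm kE ltcR.
apply: le_lt_trans (hN _ _ (leqnn N) nN) _; lra.
Qed.

Lemma nrm_complete_mono u (c : nat -> R) :
  (forall e : R, 0 < e -> exists N, c N <= e) ->
  (forall m n, (m <= n)%N -> nrm (u n - u m) <= c m) ->
  exists l : H, u @ \oo --> l.
Proof.
move=> hc hu; apply: nrm_complete => e e0.
have e20 : 0 < e / 2 by lra.
have [N hN] := hc _ e20.
exists N => m n Nm Nn; apply: le_trans (nrm_dist_triangle (u N) _ _) _.
have := hu _ _ Nm; have := hu _ _ Nn; rewrite (nrm_distC (u n)).
lra.
Qed.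

Lemma cvg_ip u v (l m : H) : u @ \oo --> l -> v @ \oo --> m ->
  (fun n => ip (u n) (v n)) @ \oo --> ip l m.
Proof.
move=> /cvg_nrmP hu /cvg_nrmP hv; apply/cvgrPdist_le => e e0.
pose K := nrm l + nrm m + 1.
have K0 : 0 < K by rewrite /K; have := nrm_ge0 l; have := nrm_ge0 m; lra.
pose d := Num.min 1 (e / K).
have d0 : 0 < d by rewrite lt_min ltr01 divr_gt0.
have [N1 h1] := hu _ d0; have [N2 h2] := hv _ d0.
exists (maxn N1 N2) => // n /=; rewrite geq_max => /andP[/h1 nu /h2 nv].
have -> : ip l m - ip (u n) (v n) =
    - (ip (u n - l) m + ip l (v n - m) + ip (u n - l) (v n - m)).
  rewrite !ipE; ring.
rewrite normrN; apply: le_trans (ler_normD _ _) _.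
apply: le_trans (_ : _ <= nrm l * d + nrm m * d + d * 1) _.
  apply: lerD.
    apply: le_trans (ler_normD _ _) _; rewrite addrC; apply: lerD.
      by apply: le_trans (abs_ip _ _) _; rewrite ler_wpM2l ?nrm_ge0.
    by apply: le_trans (abs_ip _ _) _; rewrite mulrC ler_wpM2l ?nrm_ge0.
  apply: le_trans (abs_ip _ _) _; apply: ler_pM => //; rewrite ?nrm_ge0 //.
  by apply: le_trans nv _; rewrite ge_min lexx.
have -> : nrm l * d + nrm m * d + d * 1 = K * d by rewrite /K; ring.
by rewrite -ler_pdivlMl // mulrC ge_min lexx orbT.
Qed.

Lemma cvg_nrm_le u (l : H) c : u @ \oo --> l -> (forall n, nrm (u n) <= c) ->
  nrm l <= c.
Proof.
move=> /cvg_nrmP hu hc; apply/ler_addgt0Pr => e /hu[N /(_ N (leqnn N)) h].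
have := nrmB (u N) (u N - l); rewrite opprB addrC subrK => /le_trans; apply.
by rewrite lerD.
Qed.

Lemma linear_fun_ex (f : H -> H) : linear f ->
  exists g : {linear H -> H}, g = f :> (H -> H).
Proof.
move=> lf; pose m := GRing.isLinear.Build R[i] H H *:%R f lf.
pose g : {linear H -> H} := HB.pack f m.
by exists g.
Qed.

(** [M] is positive so that it can be divided by, even for the zero operator. *)
Definition bdd (A : H -> H) := exists2 M : R, 0 < M & forall x, nrm (A x) <= M * nrm x.
Definition selfadj (A : H -> H) := forall x y, ip (A x) y = ip x (A y).
Definition commuting (A B : H -> H) := forall x, A (B x) = B (A x).

Lemma cvg_bdd (A : {linear H -> H}) u (l : H) : bdd A -> u @ \oo --> l ->
  (fun n => A (u n)) @ \oo --> A l.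
Proof.
move=> [M M0 hM] /cvg_nrmP hu; apply/cvg_nrmP => e e0.
have [N hN] := hu _ (divr_gt0 e0 M0).
exists N => n /hN h; rewrite -linearB; apply: le_trans (hM _) _.
by rewrite mulrC -ler_pdivlMr.
Qed.

Lemma strong_limit (S : nat -> {linear H -> H}) K :
  (forall n x, nrm (S n x) <= K * nrm x) ->
  (forall x, exists l : H, (fun n => S n x) @ \oo --> l) ->
  exists2 L : {linear H -> H},
    forall x, nrm (L x) <= K * nrm x & forall x, (fun n => S n x) @ \oo --> L x.
Proof.
move=> hK /choice[f hf].
have lf : linear f.
  move=> k x y; apply: cvg_unique (hf _) _ => //.
  rewrite [X in X @ _](_ : _ = (fun n => k *: S n x + S n y)); last first.
    by apply/funext => n; rewrite linearP.
  by apply: cvgD => //; apply: cvgZr.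
have [L LE] := linear_fun_ex lf; exists L; rewrite LE // => x.
exact: cvg_nrm_le (hf x) _.
Qed.

End Limits.

(** * Square roots and kernel projections *)

Section PositiveOperators.
Context {R : realType} {H : hilbertType R}.
Implicit Types (x y z w : H) (a : R) (k : R[i]) (A B S X Y Z E : {linear H -> H}).

Definition form_ge0 (A : H -> H) := forall x, 0 <= ip (A x) x.

Lemma form_le_bdd A K : (forall x, nrm (A x) <= K * nrm x) ->
  forall x, ip (A x) x <= K * ip x x.
Proof.
move=> hK x; apply: le_trans (CauchySchwarz_ip _ _) _.
by rewrite -nrm_sqr expr2 mulrA ler_wpM2r // nrm_ge0.
Qed.

Lemma selfadj_comp_ge0 A : selfadj A -> form_ge0 (A \o A).
Proof. by move=> sA x /=; rewrite sA ip_ge0. Qed.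

(* [K A (K - A) = A (K - A) A + (K - A) A (K - A)] is nonnegative. *)
Lemma form_bound_sqr A K : selfadj A -> form_ge0 A -> 0 < K ->
  (forall x, ip (A x) x <= K * ip x x) ->
  forall x, ip (A x) (A x) <= K * ip (A x) x.
Proof.
move=> sA pA K0 hK x.
have h1 := hK (A x); have h2 := pA (K%:C *: x - A x).
move: h2; rewrite linearB linearZ /= !ipE (sA (A x) x) => h2.
rewrite -(ler_pM2l K0); move: h1 h2; lra.
Qed.

Lemma form_bound_nrm A K : selfadj A -> form_ge0 A -> 0 < K ->
  (forall x, ip (A x) x <= K * ip x x) ->
  forall x, nrm (A x) <= K * nrm x.
Proof.
move=> sA pA K0 hK x; apply: nrm_le; first by rewrite mulr_ge0 ?nrm_ge0 ?ltW.
apply: le_trans (form_bound_sqr sA pA K0 hK x) _.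
by rewrite exprMn nrm_sqr expr2 -mulrA ler_pM2l.
Qed.

Lemma bdd_form_bound_sqr A : selfadj A -> form_ge0 A -> bdd A ->
  exists2 K, 0 < K & forall x, ip (A x) (A x) <= K * ip (A x) x.
Proof.
by move=> sA pA [K K0 hK]; exists K => //; apply: form_bound_sqr => // x; exact: form_le_bdd.
Qed.

Lemma form_ge0_eq0 A : selfadj A -> form_ge0 A -> bdd A ->
  forall x, ip (A x) x = 0 -> A x = 0.
Proof.
move=> sA pA bA x h; have [K _ /(_ x)] := bdd_form_bound_sqr sA pA bA.
rewrite h mulr0 => h'; apply: ip_eq0; apply/eqP.
by rewrite eq_le h' ip_ge0.
Qed.

(** The uniform bound carries the error [u n - l] through [S n]. Needed to pass to the limit in the
    squares [Y n (Y n x)]. *)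
Lemma cvg_comp_bdd (S : nat -> {linear H -> H}) K (u : nat -> H) l L : 0 < K ->
  (forall n x, nrm (S n x) <= K * nrm x) ->
  (fun n => S n l) @ \oo --> (L : H) -> u @ \oo --> l ->
  (fun n => S n (u n)) @ \oo --> L.
Proof.
move=> K0 hK /cvg_nrmP hL /cvg_nrmP hu; apply/cvg_nrmP => e e0.
have e20 : 0 < e / 2 by lra.
have [N1 h1] := hL _ e20; have [N2 h2] := hu _ (divr_gt0 e20 K0).
exists (maxn N1 N2) => n; rewrite geq_max => /andP[/h1 nL /h2 nu].
apply: le_trans (nrm_dist_triangle (S n l) _ _) _.
rewrite -linearB; have := hK n (u n - l).
have : K * nrm (u n - l) <= e / 2 by rewrite mulrC -ler_pdivlMr.
by move: nL; lra.
Qed.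

Lemma limit_selfadj (S : nat -> {linear H -> H}) L :
  (forall n, selfadj (S n)) -> (forall x, (fun n => S n x) @ \oo --> (L x : H)) ->
  selfadj L.
Proof.
move=> sS hL x y.
have h1 : (fun n => ip (S n x) y) @ \oo --> ip (L x) y.
  by apply: cvg_ip => //; apply: cvg_cst.
have h2 : (fun n => ip (S n x) y) @ \oo --> ip x (L y).
  under eq_fun do rewrite sS.
  by apply: cvg_ip => //; apply: cvg_cst.
exact: cvg_unique h1 h2.
Qed.

Lemma limit_commuting (S : nat -> {linear H -> H}) L X : bdd X ->
  (forall n, commuting X (S n)) -> (forall x, (fun n => S n x) @ \oo --> (L x : H)) ->
  commuting X L.
Proof.
move=> bX cS hL x.
have h1 := cvg_bdd bX (hL x).
have h2 : (fun n => X (S n x)) @ \oo --> L (X x).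
  by under eq_fun do rewrite cS; apply: hL.
exact: cvg_unique h1 h2.
Qed.

(* [Y = (Z + Y ^ 2) / 2] says [(1 - Y) ^ 2 = 1 - Z]; the same iteration for the
   number 1 bounds the increments of the operator iteration. *)
Section SquareRootIteration.
Variables (Z : {linear H -> H}) (sZ : selfadj Z) (hZ : forall x, nrm (Z x) <= nrm x).

Fixpoint sqrt_iter n : {linear H -> H} :=
  if n is m.+1 then (2^-1)%:C \*: (Z \+ (sqrt_iter m \o sqrt_iter m)) else \0.

Fixpoint sqrt_iterR n : R := if n is m.+1 then 2^-1 * (1 + sqrt_iterR m ^+ 2) else 0.

Local Notation Y := sqrt_iter.
Local Notation y := sqrt_iterR.

Lemma sqrt_iterS n x : Y n.+1 x = (2^-1)%:C *: (Z x + Y n (Y n x)).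
Proof. by []. Qed.

(** With [d = y n], one step multiplies [1 - d] by [(1 + d) / 2]. The rate [2 / (n + 2)] survives
    because [(1 + d) (3 - d) <= 4], that is, [(1 - d)^2 >= 0]. *)
Lemma sqrt_iterR_bound n : 0 <= y n <= 1 /\ (1 - y n) * n.+2%:R <= 2.
Proof.
elim: n => [|n [/andP[y0 y1] h]] /=; first by split; lra.
have t : (n.+3%:R = n.+2%:R + 1 :> R) by rewrite -natr1.
have t0 : 0 <= n.+2%:R :> R by [].
rewrite t; move: h t0; set t' := n.+2%:R; set d := y n in y0 y1 *.
move=> h t0; split; first by apply/andP; split; nra.
have -> : (1 - 2^-1 * (1 + d ^+ 2)) * (t' + 1) =
  (1 + d) / 2 * ((1 - d) * t' + (1 - d)) by field.
apply: (@le_trans _ _ ((1 + d) / 2 * (2 + (1 - d)))); last by nra.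
by apply: ler_wpM2l; lra.
Qed.

Lemma sqrt_iterR_small e : 0 < e -> exists N, 1 - y N <= e.
Proof.
move=> e0; have := archi_boundP (ltW (divr_gt0 (ltr0n R 2) e0)).
set N := Num.bound _ => hN; exists N.
have [_ h] := sqrt_iterR_bound N.
have N0 : 0 < N.+2%:R :> R by [].
rewrite -(ler_pM2r N0); apply: le_trans h _.
rewrite mulrC -ler_pdivrMr //; apply: le_trans (ltW hN) _.
by rewrite ler_nat -addn2 leq_addr.
Qed.

Lemma sqrt_iter_commuting X n : commuting X Z -> commuting X (Y n).
Proof.
move=> cX; elim: n => [|n IH] x; first by rewrite /= !linear0.
by rewrite !sqrt_iterS linearZ /= linearD /= cX !IH.
Qed.

Lemma sqrt_iter_comm m n : commuting (Y m) (Y n).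
Proof.
by apply: sqrt_iter_commuting => x; symmetry; apply: sqrt_iter_commuting.
Qed.

Lemma sqrt_iter_selfadj n : selfadj (Y n).
Proof.
elim: n => [|n IH] x z; first by rewrite !ipE.
by rewrite !sqrt_iterS !ipE sZ !IH.
Qed.

Lemma sqrt_iter_nrm n x : nrm (Y n x) <= y n * nrm x.
Proof.
elim: n x => [|n IH] x; first by rewrite /= nrm0 mul0r.
have [/andP[y0 _] _] := sqrt_iterR_bound n.
rewrite sqrt_iterS nrmZr ger0_norm ?invr_ge0 //=.
rewrite -mulrA ler_pM2l ?invr_gt0 // mulrDl mul1r.
apply: le_trans (nrmD _ _) (lerD (hZ x) _).
apply: le_trans (IH _) _; rewrite expr2 -mulrA ler_wpM2l //.
Qed.

Lemma sqrt_iter_nrm1 n x : nrm (Y n x) <= 1 * nrm x.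
Proof.
apply: le_trans (sqrt_iter_nrm _ _) _; rewrite ler_wpM2r ?nrm_ge0 //.
by have [/andP[]] := sqrt_iterR_bound n.
Qed.

(** The iterates commute, so the next increment is half the product of the current increment and
    [Y n.+1 + Y n]. The increments of [y] factor in the same way, which lets the induction go
    through. *)
Lemma sqrt_iter_step n x : nrm (Y n.+1 x - Y n x) <= (y n.+1 - y n) * nrm x.
Proof.
elim: n x => [|n IH] x.
  rewrite sqrt_iterS /= addr0 !subr0 nrmZr ger0_norm ?invr_ge0 // expr0n addr0 mulr1.
  by rewrite ler_pM2l ?invr_gt0.
have -> : Y n.+2 x - Y n.+1 x =
    (2^-1)%:C *: (Y n.+1 (Y n.+1 x + Y n x) - Y n (Y n.+1 x + Y n x)).
  rewrite !linearD (sqrt_iter_comm n.+1 n x) (sqrt_iterS n.+1 x).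
  have := sqrt_iterS n x; set u := Y n.+1 x => {1}->.
  by apply: ip_ext => w; rewrite !ipE; ring.
rewrite nrmZr ger0_norm ?invr_ge0 //.
apply: le_trans (ler_wpM2l _ (IH _)) _; first by rewrite invr_ge0.
have dy : 0 <= y n.+1 - y n.
  by have [/andP[y0 y1] _] := sqrt_iterR_bound n; rewrite /=; nra.
have hs : nrm (Y n.+1 x + Y n x) <= (y n.+1 + y n) * nrm x.
  by apply: le_trans (nrmD _ _) _; rewrite mulrDl lerD // sqrt_iter_nrm.
apply: le_trans (ler_wpM2l _ (ler_wpM2l dy hs)) _; first by rewrite invr_ge0.
rewrite (_ : y n.+2 = 2^-1 * (1 + y n.+1 ^+ 2)) //.
rewrite {4}(_ : y n.+1 = 2^-1 * (1 + y n ^+ 2)) //.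
by rewrite le_eqVlt; apply/orP; left; apply/eqP; ring.
Qed.

Lemma sqrt_iter_dist m n x : (m <= n)%N -> nrm (Y n x - Y m x) <= (y n - y m) * nrm x.
Proof.
move=> /subnK <-; elim: (n - m)%N => [|j IH]; first by rewrite !subrr nrm0 mul0r.
apply: le_trans (nrm_dist_triangle (Y (j + m)%N x) _ _) _.
rewrite addSn; apply: le_trans (lerD (sqrt_iter_step _ _) IH) _.
by rewrite -mulrDl addrA subrK.
Qed.

Lemma one_minus_sqrt_ex : exists Y0 : {linear H -> H},
  [/\ selfadj Y0, forall x, nrm (Y0 x) <= 1 * nrm x,
      forall x, Y0 (Y0 x) = 2%:C *: Y0 x - Z x &
      forall X, bdd X -> commuting X Z -> commuting X Y0].
Proof.
have lim x : exists l : H, (fun n => Y n x) @ \oo --> l.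
  apply: (nrm_complete_mono (c := fun n => (1 - y n) * nrm x)).
    move=> e e0; have [N hN] := sqrt_iterR_small
      (divr_gt0 e0 (ltr_pwDr ltr01 (nrm_ge0 x))).
    exists N; move: hN; rewrite ler_pdivlMr ?ltr_pwDr ?nrm_ge0 //.
    apply: le_trans; rewrite ler_wpM2l ?lerDl //.
    by have [/andP[_ ?] _] := sqrt_iterR_bound N; rewrite subr_ge0.
  move=> m n mn; apply: le_trans (sqrt_iter_dist _ mn) _.
  rewrite ler_wpM2r ?nrm_ge0 // lerD2r.
  by have [/andP[]] := sqrt_iterR_bound n.
have [Y0 bY0 hY0] := strong_limit sqrt_iter_nrm1 lim.
exists Y0; split => //.
- exact: limit_selfadj sqrt_iter_selfadj hY0.
- move=> x; have h1 : (fun n => Y n (Y n x)) @ \oo --> Y0 (Y0 x).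
    exact: cvg_comp_bdd sqrt_iter_nrm1 (hY0 _) (hY0 _).
  have h2 : (fun n => Y n.+1 x) @ \oo --> Y0 x.
    by have := hY0 x; rewrite -cvg_shiftS.
  have h3 : (fun n => 2%:C *: Y n.+1 x - Z x) @ \oo --> 2%:C *: Y0 x - Z x.
    by apply: cvgB; [apply: cvgZr|apply: cvg_cst].
  apply: cvg_unique h1 _ => //.
  suff -> : (fun n => Y n (Y n x)) = (fun n => 2%:C *: Y n.+1 x - Z x) by [].
  apply/funext => n; rewrite sqrt_iterS.
  by apply: ip_ext => z; rewrite !ipE; field.
- by move=> X bX cX; apply: limit_commuting hY0 => // n; apply: sqrt_iter_commuting.
Qed.

End SquareRootIteration.

(** The iteration is applied to [Z = 1 - A / K], for which [0 <= Z <= 1]; then [S = sqrt K (1 - Y)]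
    has [S^2 = K (1 - Z) = A]. The commutation clause is the source of uniqueness and of the later
    commutations with [S]. *)
Lemma pos_sqrt_ex A : selfadj A -> form_ge0 A -> bdd A ->
  exists S : {linear H -> H}, [/\ selfadj S, form_ge0 S, bdd S,
    forall x, S (S x) = A x &
    forall X, bdd X -> commuting X A -> commuting X S].
Proof.
move=> sA pA [K K0 bA].
pose Z : {linear H -> H} := idfun \- (K^-1)%:C \*: A.
have ZE x : Z x = x - (K^-1)%:C *: A x by [].
have sZ : selfadj Z by move=> x z; rewrite !ZE !ipE sA.
have pZ : form_ge0 Z.
  move=> x; rewrite ZE !ipE subr_ge0 mulrC ler_pdivrMr // mulrC.
  exact: form_le_bdd.
have leZ x : ip (Z x) x <= 1 * ip x x.
  by rewrite mul1r ZE !ipE gerBl mulr_ge0 // invr_ge0 ltW.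
have nZ x : nrm (Z x) <= nrm x by rewrite -(mul1r (nrm x)) form_bound_nrm.
have [Y [sY bY YY cY]] := one_minus_sqrt_ex sZ nZ.
pose c := Num.sqrt K.
pose S : {linear H -> H} := c%:C \*: (idfun \- Y).
have SE x : S x = c%:C *: (x - Y x) by [].
have c0 : 0 <= c by apply: sqrtr_ge0.
have cc : c * c = K by rewrite -expr2 sqr_sqrtr // ltW.
exists S; split.
- by move=> x z; rewrite !SE !ipE sY.
- move=> x; rewrite SE !ipE mulr_ge0 // subr_ge0.
  by have := form_le_bdd bY x; rewrite mul1r.
- exists (c * 2 + 1) => [|x]; first by rewrite ltr_wpDl // mulr_ge0.
  rewrite SE nrmZr ger0_norm // mulrDl mul1r ler_wpDr ?nrm_ge0 //.
  rewrite -mulrA ler_wpM2l //; apply: le_trans (nrmB _ _) _.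
  by have := bY x; lra.
- move=> x; rewrite !SE (linearZZ Y) (linearB Y) YY.
  have cn0 : c != 0 by rewrite gt_eqF // sqrtr_gt0.
  by apply: ip_ext => z; rewrite ZE !ipE -cc; field.
- move=> X bX cX x; rewrite !SE linearZ /= linearB /= cY //.
  by move=> z; rewrite !ZE linearB linearZ /= cX.
Qed.

(** For [y = (S1 - S2) x], commutation gives [(S1 + S2) y = 0]. Two nonnegative forms with sum zero
    vanish, so [S1 y = S2 y = 0], and then [(y, y) = (S1 y - S2 y, x) = 0]. *)
Lemma pos_sqrt_unique_comm S1 S2 : selfadj S1 -> form_ge0 S1 -> bdd S1 ->
  selfadj S2 -> form_ge0 S2 -> bdd S2 ->
  (forall x, S1 (S1 x) = S2 (S2 x)) -> commuting S1 S2 -> forall x, S1 x = S2 x.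
Proof.
move=> s1 p1 b1 s2 p2 b2 h c x; set y := S1 x - S2 x.
have h0 : S1 y + S2 y = 0.
  by rewrite /y !linearB /= h c addrA subrK subrr.
have hs : ip (S1 y) y + ip (S2 y) y = 0 by rewrite -ipDl h0 ip0l.
have e1 : S1 y = 0.
  by apply: form_ge0_eq0 => //; have := p1 y; have := p2 y; lra.
have e2 : S2 y = 0.
  by apply: form_ge0_eq0 => //; have := p1 y; have := p2 y; lra.
apply/subr0_eq/ip_eq0; rewrite -/y {2}/y ipDr ipNr -s1 -s2 e1 e2 !ip0l.
by rewrite subrr.
Qed.

Lemma bdd_comp (A B : H -> H) : bdd A -> bdd B -> bdd (A \o B).
Proof.
move=> [M M0 hM] [N N0 hN]; exists (M * N) => [|x]; first by rewrite mulr_gt0.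
by apply: le_trans (hM _) _; rewrite -mulrA ler_wpM2l // ltW.
Qed.

(** [S1] and [S2] need not commute with each other a priori; each commutes with the root constructed
    from their common square, and is compared with that one. *)
Lemma pos_sqrt_unique S1 S2 : selfadj S1 -> form_ge0 S1 -> bdd S1 ->
  selfadj S2 -> form_ge0 S2 -> bdd S2 ->
  (forall x, S1 (S1 x) = S2 (S2 x)) -> forall x, S1 x = S2 x.
Proof.
move=> s1 p1 b1 s2 p2 b2 h x.
have s11 : selfadj (S1 \o S1) by move=> u v /=; rewrite !s1.
have [S [s p b hS cS]] := pos_sqrt_ex s11 (selfadj_comp_ge0 s1) (bdd_comp b1 b1).
have -> : S1 x = S x.
  by symmetry; apply: pos_sqrt_unique_comm => // u; symmetry; apply: cS.
apply: pos_sqrt_unique_comm => // u; first by rewrite hS /= h.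
by symmetry; apply: cS => // v /=; rewrite !h.
Qed.

(* The powers of [0 <= Z <= 1] converge strongly to the projection onto the fixed
   points of [Z]. *)
Section KernelProjection.
Variables (Z : {linear H -> H}) (sZ : selfadj Z) (pZ : form_ge0 Z).
Hypothesis leZ : forall x, ip (Z x) x <= 1 * ip x x.

Fixpoint powop n : {linear H -> H} := if n is m.+1 then Z \o powop m else idfun.

Lemma powopS n x : powop n.+1 x = Z (powop n x). Proof. by []. Qed.

Lemma powop_commuting X n : commuting X Z -> commuting X (powop n).
Proof. by move=> cX; elim: n => [|n IH] x //; rewrite !powopS cX IH. Qed.

Lemma powopSr n x : powop n.+1 x = powop n (Z x).
Proof. by rewrite powopS powop_commuting. Qed.

Lemma powop_selfadj n : selfadj (powop n).
Proof. by elim: n => [|n IH] x z //; rewrite powopS sZ IH powopSr. Qed.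

Lemma ip_powop m n x : ip (powop m x) (powop n x) = ip (powop (m + n) x) x.
Proof.
rewrite powop_selfadj ipC; congr (ip _ x).
by elim: m => [|m IH] //; rewrite addSn !powopS -IH.
Qed.

Lemma powop_form n x :
  0 <= ip (powop n.+1 x) x <= ip (powop n x) x.
Proof.
(* Two consecutive cases go together: the induction replaces [x] by [Z x], which raises the exponent
   in [ip (powop n x) x] by two. *)
suff : (0 <= ip (powop n.+1 x) x <= ip (powop n x) x) /\
  (0 <= ip (powop n.+2 x) x <= ip (powop n.+1 x) x) by case.
elim: n x => [|n IH] x.
  split; apply/andP; split => /=; first exact: pZ.
  - by have := leZ x; rewrite mul1r.
  - by rewrite sZ ip_ge0.
  - by have := form_bound_sqr sZ pZ ltr01 leZ x; rewrite mul1r -sZ.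
split; first by have [_ h] := IH x; exact: h.
have e m : ip (powop m (Z x)) (Z x) = ip (powop m.+2 x) x.
  by rewrite -sZ -powopS -powopSr.
by have [+ _] := IH (Z x); rewrite !e.
Qed.

Lemma powop_nrm n x : nrm (powop n x) <= 1 * nrm x.
Proof.
elim: n => [|n IH]; first by rewrite mul1r.
rewrite powopS; apply: le_trans IH.
by rewrite -[leRHS]mul1r; exact: form_bound_nrm.
Qed.

Lemma powop_cvg x : exists l : H, (fun n => powop n x) @ \oo --> l.
Proof.
pose c n := ip (powop n x) x.
have cmono : {homo c : m n / (m <= n)%N >-> n <= m}.
  apply: homo_leq => [//|u v w /[swap]|n]; first exact: le_trans.
  by case/andP: (powop_form n x).
have c0 n : 0 <= c n.
  by have /andP[h1 h2] := powop_form n x; apply: le_trans h1 h2.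
have : cvgn c.
  apply: nonincreasing_is_cvgn => //.
  by exists 0 => _ [n _ <-].
move=> /cvg_ex[l /cvgrPdist_le hl].
apply: nrm_complete => e e0.
(* The square distance of two powers is [c (m + m) - 2 c (m + n) + c (n + n)]: four values, each
   within [e^2 / 4] of the limit. *)
have e40 : 0 < e ^+ 2 / 4 by rewrite divr_gt0 // exprn_gt0.
have [N _ hN] := hl _ e40.
exists N => m n Nm Nn; apply: nrm_le; first exact: ltW.
have hk i : (N <= i)%N -> `|l - c i| <= e ^+ 2 / 4 by move=> /hN.
rewrite !ipE !ip_powop (addnC n m) -!/(c _).
have /hk : (N <= m + m)%N by apply: leq_trans Nm (leq_addr _ _).
have /hk : (N <= m + n)%N by apply: leq_trans Nm (leq_addr _ _).
have /hk : (N <= n + n)%N by apply: leq_trans Nn (leq_addr _ _).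
rewrite !ler_norml => /andP[a1 b1] /andP[a2 b2] /andP[a3 b3].
move: a1 b1 a2 b2 a3 b3; lra.
Qed.

Lemma fixed_projection_ex : exists E : {linear H -> H}, [/\ selfadj E,
    forall x, nrm (E x) <= 1 * nrm x, forall x, Z (E x) = E x, forall x, Z x = x -> E x = x &
    forall X, bdd X -> commuting X Z -> commuting X E].
Proof.
have [E bE hE] := strong_limit powop_nrm powop_cvg.
have bZ : bdd Z by exists 1 => //; apply: form_bound_nrm.
have hZ x : Z (E x) = E x.
  have h1 := cvg_bdd bZ (hE x).
  have h2 : (fun n => powop n.+1 x) @ \oo --> E x.
    by have := hE x; rewrite -cvg_shiftS.
  exact: cvg_unique h1 h2.
exists E; split => //.
- exact: limit_selfadj powop_selfadj hE.
- move=> x hx; have := hE x.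
  rewrite (_ : (fun n => _) = (fun=> x)); last first.
    apply/funext => n; elim: n => [|n IH] //; rewrite powopS IH //.
  move=> h; apply: cvg_unique h _ => //; exact: cvg_cst.
- by move=> X bX cX; apply: limit_commuting hE => // n; apply: powop_commuting.
Qed.

End KernelProjection.

(** [Z = 1 - B^2 / K^2] satisfies [0 <= Z <= 1] whatever the sign of [B], and its fixed points form
    the kernel of [B], since [(x - Z x, x) = |B x|^2 / K^2]. *)
Lemma kernel_projection_ex B : selfadj B -> bdd B ->
  exists E : {linear H -> H}, [/\ selfadj E, forall x, E (E x) = E x,
    forall x, B (E x) = 0, forall x, B x = 0 -> E x = x &
    forall X, bdd X -> commuting X B -> commuting X E].
Proof.
move=> sB [K K0 bB].
pose Z : {linear H -> H} := idfun \- (K ^- 2)%:C \*: (B \o B).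
have ZE x : Z x = x - (K ^- 2)%:C *: B (B x) by [].
have K20 : 0 < K ^+ 2 by rewrite exprn_gt0.
have sZ : selfadj Z by move=> x z; rewrite !ZE !ipE !sB.
have pZ : form_ge0 Z.
  move=> x; rewrite ZE !ipE subr_ge0 mulrC ler_pdivrMr // mulrC sB -!nrm_sqr.
  by rewrite -exprMn ler_sqr ?nnegrE ?mulr_ge0 ?nrm_ge0 // ltW.
have leZ x : ip (Z x) x <= 1 * ip x x.
  by rewrite mul1r ZE !ipE gerBl sB mulr_ge0 ?ip_ge0 ?invr_ge0 ?(ltW K20).
have [E [sE _ ZEE hE cE]] := fixed_projection_ex sZ pZ leZ.
exists E; split => //.
- by move=> x; apply: hE.
- move=> x; apply: ip_eq0.
  have := congr1 (fun v => ip v (E x)) (ZEE x); rewrite ZE !ipE sB => h.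
  have : K ^- 2 * ip (B (E x)) (B (E x)) = 0 by move: h; lra.
  by move/eqP; rewrite mulf_eq0 invr_eq0 gt_eqF //= => /eqP.
- by move=> x hx; apply: hE; rewrite ZE hx linear0 scaler0 subr0.
- move=> X bX cX; apply: cE => // x.
  by rewrite !ZE linearB linearZ /= !cX.
Qed.

End PositiveOperators.

(** * From complex to real formulations of operator properties *)

Section Bridge.
Context {R : realType} {H : hilbertType R}.
Implicit Types (x y z w : H) (a : R) (k : R[i]) (A B S X Y Z : {linear H -> H}).

Lemma conjC_i : Num.conj_op (Complex 0 1 : R[i]) = Complex 0 (-1).
Proof. by []. Qed.

(** Conjugate linearity in the second argument gives [hdot x (i y) = - i hdot x y]. Hence an
    identity of real parts valid for all [y] lifts to [hdot]. *)
Lemma Im_hdot x y : complex.Im (hdot x y) = ip x (Complex 0 1 *: y).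
Proof. by rewrite /ip linearZr_LR /= conjC_i; case: (hdot x y) => a b; rewrite /=; ring. Qed.

Lemma selfadj_hdot A : selfadj A -> forall x y, hdot (A x) y = hdot x (A y).
Proof.
move=> sA x y; apply/eqP; rewrite eq_complex !Im_hdot.
by rewrite -/(ip _ _) -/(ip _ _) !sA linearZ !eqxx.
Qed.

Lemma selfadj_hdotE A x : selfadj A -> hdot (A x) x = (ip (A x) x)%:C.
Proof.
move=> sA; apply/eqP; rewrite eq_complex /= eqxx /=.
have := selfadj_hdot sA x x; rewrite [X in _ = X]hdotC.
case: (hdot (A x) x) => a b [] /= /eqP; rewrite -addr_eq0 => h.
by apply/eqP; move/eqP: h; lra.
Qed.

Lemma bddP (A : H -> H) : bdd A <-> exists M : R, forall x, `|A x| <= M%:C * `|x|.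
Proof.
split=> [[M _ hM]|[M hM]].
  by exists M => x; rewrite !normrE_nrm -rmorphM lecR.
exists (`|M| + 1) => [|x]; first by rewrite ltr_wpDl.
have := hM x; rewrite !normrE_nrm -rmorphM lecR => /le_trans; apply.
by rewrite ler_wpM2r ?nrm_ge0 // ler_wpDr // ler_norm.
Qed.

Lemma bounded_opP (T : H -> H) : bounded_op T -> exists2 A : {linear H -> H}, A = T :> (H -> H) & bdd A.
Proof. by move=> [/linear_fun_ex[A <-] /bddP bT]; exists A. Qed.

Lemma bounded_op_linear A : bdd A -> bounded_op A.
Proof. by move=> /bddP bA; split => // k x y; rewrite linearP. Qed.

Lemma op_leP A B : selfadj A -> selfadj B -> (op_le A B <-> forall x, ip (A x) x <= ip (B x) x).
Proof.
by move=> sA sB; split => h x; have := h x; rewrite !selfadj_hdotE // lecR.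
Qed.

(** Polarization: the imaginary part of the form at [x + i y] is [ip (A y) x - ip (A x) y]. *)
Lemma form_real_selfadj A : (forall x, complex.Im (hdot (A x) x) = 0) -> selfadj A.
Proof.
move=> h x y; have hx := h x; have hy := h y.
have := h (x + Complex 0 1 *: y).
rewrite (linearD A) linearZZ linearDl !linearDr !linearZl_LR !linearZr_LR /= conjC_i.
rewrite (ipC x) /ip; move: hx hy.
case: (hdot (A x) x) => a1 b1; case: (hdot (A y) y) => a2 b2.
case: (hdot (A x) y) => a3 b3; case: (hdot (A y) x) => a4 b4 /= -> ->; lra.
Qed.

Lemma positive_opP (T : H -> H) : positive_op T ->
  exists A : {linear H -> H}, [/\ A = T :> (H -> H), bdd A, selfadj A & form_ge0 A].
Proof.
move=> [/bounded_opP[A <- bA] pA]; exists A.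
have sA : selfadj A by apply: form_real_selfadj => x; rewrite ger0_Im.
by split => // x; have := pA x; rewrite selfadj_hdotE // lecR.
Qed.

Lemma positive_op_linear A : bdd A -> selfadj A -> form_ge0 A -> positive_op A.
Proof.
by move=> bA sA pA; split; [exact: bounded_op_linear|move=> x; rewrite selfadj_hdotE // lecR].
Qed.

Lemma proj_nrm A : selfadj A -> (forall x, A (A x) = A x) -> forall x, nrm (A x) <= 1 * nrm x.
Proof.
move=> sA iA x; rewrite mul1r; have := CauchySchwarz_ip (A x) x.
rewrite -{1}iA sA -nrm_sqr expr2; have := nrm_ge0 (A x).
rewrite le_eqVlt => /orP[/eqP <- _|n0]; first exact: nrm_ge0.
by rewrite ler_pM2l.
Qed.

Lemma projection_op_linear A : selfadj A -> (forall x, A (A x) = A x) -> projection_op A.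
Proof.
move=> sA iA; split; last exact: selfadj_hdot.
  by apply: bounded_op_linear; exists 1 => //; apply: proj_nrm.
exact/funext.
Qed.

End Bridge.

(** * Orthogonal resolutions of the identity *)

Section Resolutions.
Context {R : realType} {H : hilbertType R}.
Implicit Types (x y z w v : H).

Definition identity_resolution (I : finType) (P : I -> H -> H) :=
  (forall i j, i != j -> forall x y, ip (P i x) (P j y) = 0) /\
  forall x, \sum_i P i x = x.

Lemma ip_sum_orthogonal (I : finType) (u : I -> H) :
  (forall i j, i != j -> ip (u i) (u j) = 0) ->
  ip (\sum_i u i) (\sum_i u i) = \sum_i ip (u i) (u i).
Proof.
move=> h; rewrite ip_suml; apply: eq_bigr => i _.
rewrite ip_sumr (bigD1 i) //= big1 ?addr0 // => j ji.
by rewrite h // eq_sym.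
Qed.

(** Pythagoras applies to both sums, so the number of pieces does not enter the bound. This is what
    makes Riemann sums converge in operator norm. *)
Lemma resolution_sum_bound (I : finType) (P : I -> H -> H) (u : I -> H) e v :
  identity_resolution P -> 0 <= e ->
  (forall i j, i != j -> ip (u i) (u j) = 0) ->
  (forall i, nrm (u i) <= e * nrm (P i v)) ->
  nrm (\sum_i u i) <= e * nrm v.
Proof.
move=> [oP sP] e0 ou hu; apply: nrm_le; first by rewrite mulr_ge0 ?nrm_ge0.
rewrite ip_sum_orthogonal // exprMn nrm_sqr.
rewrite -(sP v) ip_sum_orthogonal => [|i j ij]; last exact: oP.
rewrite mulr_sumr; apply: ler_sum => i _.
by rewrite -!nrm_sqr -exprMn ler_sqr ?nnegrE ?mulr_ge0 ?nrm_ge0.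
Qed.

Lemma resolution_mul (I J : finType) (P : I -> H -> H) (Q : J -> {linear H -> H}) :
  identity_resolution P -> identity_resolution Q ->
  (forall i j, commuting (P i) (Q j)) ->
  identity_resolution (fun ij : I * J => P ij.1 \o Q ij.2).
Proof.
move=> [oP sP] [oQ sQ] c; split => [[i j] [i' j']|x] /=.
  have [-> ij x y|ii _ x y] := eqVneq i i'; last exact: oP.
  rewrite !c; apply: oQ; apply: contra ij => /eqP ->; exact: eqxx.
rewrite -(pair_bigA _ (fun i j => P i (Q j x))) /=.
under eq_bigr do under eq_bigr do rewrite c.
rewrite exchange_big /= -[RHS]sQ; apply: eq_bigr => j _.
by rewrite -linear_sum sP.
Qed.

Definition projection_chain (E : R -> {linear H -> H}) :=
  [/\ forall s, selfadj (E s), forall s x, E s (E s x) = E s x &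
      forall s t, s <= t -> forall x, E t (E s x) = E s x].

Lemma projection_chainC E : projection_chain E ->
  forall s t, s <= t -> forall x, E s (E t x) = E s x.
Proof.
by move=> [sE iE mE] s t st x; apply: ip_ext => y; rewrite !sE mE.
Qed.

Definition inc (E : R -> {linear H -> H}) (x : nat -> R) i : {linear H -> H} :=
  E (x i.+1) \- E (x i).

Lemma incE E (x : nat -> R) i v : inc E x i v = E (x i.+1) v - E (x i) v. Proof. by []. Qed.

Lemma inc_selfadj E (x : nat -> R) i : projection_chain E -> selfadj (inc E x i).
Proof. by move=> [sE _ _] y z; rewrite !incE !ipE !sE. Qed.


Lemma partition_homo (E : R -> H -> H) d n (x xi : nat -> R) : tagged_partition E d n x xi ->
  forall i j, (i <= j)%N -> (j <= n)%N -> x i <= x j.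
Proof.
move=> [_ _ h] i j /subnK <-; elim: (j - i)%N => [|k IH] // ki.
have [h1 h2 _] := h (k + i)%N ki.
apply: le_trans (IH (ltnW ki)) _; exact: le_trans h1 h2.
Qed.

Lemma partition_resolution E d n (x xi : nat -> R) : projection_chain E ->
  tagged_partition E d n x xi -> identity_resolution (fun i : 'I_n => inc E x i).
Proof.
move=> cE pE; have xm := partition_homo pE; have [e0 en _] := pE.
have [sE iE mE] := cE.
have o (i j : 'I_n) : (i < j)%N -> forall y z, ip (inc E x i y) (inc E x j z) = 0.
  move=> ij y z; have jn := ltn_ord j.
  have h s t : s <= t -> ip (E s y) (E t z) = ip (E s y) z.
    by move=> st; rewrite -sE mE.
  rewrite !incE !ipE !h ?xm //; first ring.
  - exact: ltnW.
  - exact: ltnW.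
  - exact: leqW (ltnW ij).
  - exact: ltnW.
  - by rewrite ltnS ltnW.
split=> [i j ij y z|v].
  have : i != j :> nat by [].
  case: ltngtP => // [ij' _|ji _]; first exact: o.
  by rewrite ipC o.
rewrite -(big_mkord xpredT (fun i => inc E x i v)) telescope_sumr //.
by rewrite en (congr1 (fun f => f v) e0) /op0 subr0.
Qed.

End Resolutions.

(** * The spectral theorem *)

Section SpectralTheorem.
Context {R : realType} {H : hilbertType R}.
Implicit Types (x y z w v : H) (a s t : R) (X Y : {linear H -> H}).

(* The projection onto the kernel of [|A - s| + (A - s)]. *)
Lemma spectral_cut_ex (A : {linear H -> H}) s : selfadj A -> bdd A ->
  exists E : {linear H -> H}, [/\ selfadj E /\ (forall x, E (E x) = E x),
    forall x, ip (A (E x)) (E x) <= s * ip (E x) (E x),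
    forall x, E x = 0 -> s * ip x x <= ip (A x) x,
    forall x, E x = 0 -> ip (A x) x = s * ip x x -> x = 0 &
    forall X, bdd X -> commuting X A -> commuting X E].
Proof.
move=> sA [K K0 bA].
have [X XE] : exists X : {linear H -> H}, forall x, X x = A x - s%:C *: x.
  by exists (A \- s%:C \*: idfun).
have sX : selfadj X by move=> x y; rewrite !XE !ipE sA.
have bX : bdd X.
  exists (K + `|s|) => [|x]; first by rewrite ltr_pwDl.
  by rewrite XE mulrDl; apply: le_trans (nrmB _ _) _; rewrite nrmZr lerD2r.
have cX Y : commuting Y A -> commuting Y X.
  by move=> c x; rewrite !XE linearB linearZZ c.
have sXX : selfadj (X \o X) by move=> x y /=; rewrite !sX.
have [S [sS pS bS SS cS]] := pos_sqrt_ex sXX (selfadj_comp_ge0 sX) (bdd_comp bX bX).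
have SX x : S (X x) = X (S x) by rewrite -cS.
have [P PE] : exists P : {linear H -> H}, forall x, P x = S x + X x.
  by exists (S \+ X).
have sP : selfadj P by move=> x y; rewrite !PE !ipE sS sX.
have bP : bdd P.
  have [M1 M10 h1] := bS; have [M2 M20 h2] := bX.
  exists (M1 + M2) => [|x]; first exact: addr_gt0.
  by rewrite PE mulrDl; apply: le_trans (nrmD _ _) (lerD _ _).
have [E [sE iE kE hE cE]] := kernel_projection_ex sP bP.
(* [(S + X) (S - X) = S^2 - X^2 = 0], so [E] fixes the range of [S - X], which is therefore
   orthogonal to the kernel of [E]. *)
have E0 x : E x = 0 -> ip (X x) x = ip (S x) x.
  move=> Ex; have h : E (S x - X x) = S x - X x.
    apply: hE; rewrite PE [S (_ - _)]linearB [X (_ - _)]linearB SS SX /=.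
    by rewrite addrC subrKA subrr.
  apply/esym/subr0_eq; rewrite -ipNl -ipDl -h sE Ex ip0r //.
have ipX x : ip (X x) x = ip (A x) x - s * ip x x by rewrite XE !ipE.
exists E; split => //.
- move=> x; have := kE x; rewrite PE => /eqP; rewrite addrC addr_eq0 => /eqP h.
  by rewrite -subr_le0 -ipX h ipNl oppr_le0.
- by move=> x Ex; rewrite -subr_ge0 -ipX E0.
- move=> x Ex /eqP; rewrite -subr_eq0 -ipX => /eqP Xx.
  have Sx : S x = 0 by apply: form_ge0_eq0 => //; rewrite -E0.
  have X0 : X x = 0.
    by apply: ip_eq0; rewrite -sX -[X (X x)]/((X \o X) x) -SS Sx linear0 ip0l.
  by rewrite -Ex hE // PE Sx X0 addr0.
- move=> Y bY cY; apply: cE => // x; rewrite !PE linearD cX // cS //.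
  by move=> y /=; rewrite !(cX _ cY).
Qed.

Theorem spectral_resolution_ex (A : {linear H -> H}) : selfadj A -> bdd A ->
  exists E : R -> {linear H -> H}, spectral_resolution A E.
Proof.
move=> sA bA.
have [E hE] := choice (fun s => spectral_cut_ex s sA bA).
have sE s : selfadj (E s) by case: (hE s) => -[].
have iE s x : E s (E s x) = E s x by case: (hE s) => -[].
have lo s x : ip (A (E s x)) (E s x) <= s * ip (E s x) (E s x) by case: (hE s).
have hi s x : E s x = 0 -> s * ip x x <= ip (A x) x.
  by case: (hE s) => _ _ h _ _; apply: h.
have eqx s x : E s x = 0 -> ip (A x) x = s * ip x x -> x = 0.
  by case: (hE s) => _ _ _ h _; apply: h.
have cE s X : bdd X -> commuting X A -> commuting X (E s).
  by case: (hE s) => _ _ _ _ h; apply: h.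
have nE s := proj_nrm (sE s) (iE s).
have bE s : bdd (E s) by exists 1 => //; apply: nE.
have cAE s : commuting A (E s) by apply: cE.
have cEE s t : commuting (E s) (E t) by apply: cE => // x; rewrite -cAE.
have mE s t : s <= t -> forall x, E t (E s x) = E s x.
  rewrite le_eqVlt => /orP[/eqP-> //|st] x.
  (* [w] is in the range of [E s] and the kernel of [E t]: its form under [A] is at most [s |w|^2]
     and at least [t |w|^2]. *)
  apply/esym/subr0_eq/ip_eq0; set w := E s x - E t (E s x).
  have wt : E t w = 0 by rewrite /w linearB iE subrr.
  have ws : E s w = w by rewrite /w linearB iE cEE iE.
  have := lo s w; have := hi t w wt; rewrite ws => h1 h2.
  have : (t - s) * ip w w <= 0 by move: h1 h2; lra.
  rewrite pmulr_rle0 ?subr_gt0 // => h; apply/eqP.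
  by rewrite eq_le h ip_ge0.
have chE : projection_chain E by [].
have mE' := projection_chainC chE.
have leE s t x : s <= t -> ip (E s x) x <= ip (E t x) x.
  have hn r : ip (E r x) x = nrm (E r x) ^+ 2 by rewrite nrm_sqr -sE iE.
  move=> st; rewrite !hn ler_sqr ?nnegrE ?nrm_ge0 // -(mE' _ _ st).
  by rewrite -[leRHS]mul1r.
(* A decreasing sequence of projections converges strongly. For the limit [l], the vector
   [w = l - E s v] is killed by [E s], yet lies in the range of [E t] for all [t > s]; its form is
   then exactly [s |w|^2], and the equality clause of the cut gives [w = 0]. *)
have rc s v : E t v @[t --> s^'+] --> E s v.
  pose u n := E (s + n.+1%:R^-1) v.
  have tn n m : (n <= m)%N -> s + m.+1%:R^-1 <= s + n.+1%:R^-1 :> R.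
    by move=> nm; rewrite lerD2l lef_pV2 ?posrE // ler_nat ltnS.
  have st n : s <= s + n.+1%:R^-1 by rewrite lerDl invr_ge0.
  have d2 a b : a <= b -> nrm (E b v - E a v) ^+ 2 = ip (E b v) v - ip (E a v) v.
    move=> ab; rewrite nrm_sqr !ipE -!sE !iE (mE _ _ ab) (mE' _ _ ab); ring.
  have [l hl] : exists l : H, u @ \oo --> l.
    pose c n := ip (u n) v.
    have cmono : {homo c : m n / (m <= n)%N >-> n <= m}.
      by move=> m n mn; apply/leE/tn.
    have c0 n : 0 <= c n by rewrite /c /u -iE sE ip_ge0.
    have : cvgn c by apply: nonincreasing_is_cvgn => //; exists 0 => _ [n _ <-].
    move=> /cvg_ex[l /cvgrPdist_le hl].
    apply: nrm_complete => e e0.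
    have e20 : 0 < e ^+ 2 / 2 by rewrite divr_gt0 // exprn_gt0.
    have [N _ hN] := hl _ e20; exists N => m n.
    wlog mn : m n / (m <= n)%N.
      move=> hw Nm Nn; have [mn|/ltnW nm] := leqP m n; first exact: hw.
      by rewrite nrm_distC; apply: hw.
    move=> /hN /= h1 /hN /= h2; apply: nrm_le; first exact: ltW.
    rewrite -nrm_sqr d2 ?tn // -!/(c _).
    by move: h1 h2; rewrite !ler_norml => /andP[? ?] /andP[? ?]; lra.
  have Esl : E s l = E s v.
    have h1 := cvg_bdd (bE s) hl.
    have h2 : (fun n => E s (u n)) @ \oo --> E s v.
      by under eq_fun do rewrite /u mE' //; apply: cvg_cst.
    exact: cvg_unique h1 h2.
  have Etl t : s < t -> E t l = l.
    move=> lst; have [N hN] := ltr_add_invr lst.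
    apply/subr0_eq/nrm_small_eq0 => e e0.
    have e20 : 0 < e / 2 by lra.
    have /cvg_nrmP/(_ _ e20)[M hM] := hl.
    have := hM (maxn M N) (leq_maxl _ _); set n := maxn M N => hn.
    have Eu : E t (u n) = u n.
      by rewrite mE //; apply: le_trans (ltW hN); apply: tn; exact: leq_maxr.
    apply: le_trans (nrm_dist_triangle (E t (u n)) _ _) _.
    rewrite {2}Eu -linearB.
    have := nE t (l - u n); rewrite nrm_distC mul1r in hn *; move: hn; lra.
  have ls : l = E s v.
    apply/subr0_eq; set w := l - E s v.
    have Ew : E s w = 0 by rewrite /w linearB Esl iE subrr.
    have wle : ip (A w) w <= s * ip w w.
      apply/ler_addgt0Pr => e e0.
      have i0 : 0 < ip w w + 1 by rewrite ltr_pwDr // ip_ge0.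
      have d0 : 0 < e / (ip w w + 1) by rewrite divr_gt0.
      have lst : s < s + e / (ip w w + 1) by rewrite ltrDl.
      have Etw : E (s + e / (ip w w + 1)) w = w.
        by rewrite /w linearB Etl // mE // ltW.
      have := lo (s + e / (ip w w + 1)) w; rewrite Etw => /le_trans; apply.
      rewrite mulrDl lerD2l -mulrA ger_pMr //.
      by rewrite mulrC ler_pdivrMr // mul1r lerDl.
    apply: (eqx s) => //; apply/eqP; rewrite eq_le wle /=; exact: hi.
  apply/cvgrPdist_le => k k0.
  have kE : k = (complex.Re k)%:C by rewrite RRe_real // gtr0_real.
  have r0 : 0 < complex.Re k by rewrite -ltcR -kE.
  have /cvg_nrmP/(_ _ r0)[N /(_ N (leqnn N)) hN] := hl.
  near=> t.
  have lst : s <= t by near: t; exact: nbhs_right_ge.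
  have ltN : t <= s + N.+1%:R^-1.
    near: t; apply: nbhs_right_le; by rewrite ltrDl invr_gt0.
  rewrite normrE_nrm kE lecR nrm_distC; apply: le_trans hN.
  have -> : E t v - E s v = E t (u N - l).
    by rewrite linearB /u mE' // ls mE.
  by apply: le_trans (nE _ _) _; rewrite mul1r.
have [M M0 bM] := bA.
have formA x : - M * ip x x <= ip (A x) x <= M * ip x x.
  rewrite (form_le_bdd bM) andbT -nrm_sqr mulNr lerNl -ipNl.
  apply: le_trans (CauchySchwarz_ip _ _) _; rewrite nrmN expr2 mulrA.
  by rewrite ler_wpM2r ?nrm_ge0.
exists E; split; first split.
- by move=> s; apply: projection_op_linear.
- by move=> s t st; apply/op_leP => // x; apply: leE.
- exact: rc.
(* The equality clause of the cut is what covers the endpoint [s = M]. *)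
- exists (- M), M; split => s hs; apply/funext => x.
    apply: ip_eq0; apply/eqP; rewrite eq_le ip_ge0 andbT.
    have := lo s x; have /andP[h _] := formA (E s x) => h'.
    have : (- M - s) * ip (E s x) (E s x) <= 0 by move: h h'; lra.
    by rewrite pmulr_rle0 // subr_gt0.
  apply/esym/subr0_eq; apply: (eqx s); first by rewrite linearB iE subrr.
  set w := _ - _; apply/eqP; rewrite eq_le hi ?andbT; last by rewrite linearB iE subrr.
  have /andP[_ h] := formA w; apply: le_trans h _.
  by rewrite ler_wpM2r // ip_ge0.
(* On each cell, half of [e] is spent between [A] and the left endpoint, half between the left
   endpoint and the tag. *)
move=> e e0; exists (e / 2); first lra.
move=> n x xi pE v.
have rP := partition_resolution chE pE.
have xm := partition_homo pE; have [_ _ hx] := pE.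
have cI i : commuting A (inc E x i).
  by move=> y; rewrite !incE linearB !cAE.
rewrite -[X in A X](proj2 rP v) linear_sum -sumrB.
have -> : \sum_(i < n) ((id (xi i))%:C *: increment (fun s => E s) x i v - A (inc E x i v)) =
    \sum_(i < n) inc E x i ((xi i)%:C *: v - A v).
  by apply: eq_bigr => i _; rewrite [RHS]linearB [in RHS]linearZZ -cI.
rewrite !normrE_nrm -rmorphM lecR; apply: (resolution_sum_bound rP); first exact: ltW.
  by move=> i j ij; apply: (proj1 rP).
move=> i; have [a1 a2 a3] := hx i (ltn_ord i); set w := inc E x i v.
have xx : x i <= x i.+1 by apply: le_trans a1 a2.
have incI y : inc E x i (inc E x i y) = inc E x i y.
  rewrite !incE ![E _ (_ - _)]linearB !iE mE // mE' //.
  by rewrite subrr subr0.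
(* The compression of [A - x i] to the cell is positive with form at most [e / 2], so
   [form_bound_nrm] applies. *)
have [Z ZE] : exists Z : {linear H -> H}, forall y, Z y = inc E x i (A y - (x i)%:C *: y).
  by exists (inc E x i \o (A \- (x i)%:C \*: idfun)).
have sI := inc_selfadj x i chE.
have ZI y : Z y = A (inc E x i y) - (x i)%:C *: inc E x i y.
  by rewrite ZE linearB linearZZ -cI.
have sZ : selfadj Z.
  by move=> y z; rewrite ZE ZI sI ipDl ipNl ipZl sA !ipE.
have formZ y : ip (Z y) y = ip (A (inc E x i y)) (inc E x i y) - x i * ip (inc E x i y) (inc E x i y).
  have -> : Z y = inc E x i (Z y) by rewrite ZE incI.
  by rewrite sI ZI ipDl ipNl ipZl.
have pZ : form_ge0 Z.
  move=> y; rewrite formZ subr_ge0; apply: hi.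
  by rewrite incE linearB iE mE' // subrr.
have leZ y : ip (Z y) y <= e / 2 * ip y y.
  have : ip (Z y) y <= (x i.+1 - x i) * ip (inc E x i y) (inc E x i y).
    rewrite formZ mulrBl lerD2r.
    have e1 : E (x i.+1) (inc E x i y) = inc E x i y by rewrite incE linearB iE mE.
    by have := lo (x i.+1) (inc E x i y); rewrite e1.
  move=> /le_trans; apply; apply: ler_pM => //; rewrite ?subr_ge0 ?ip_ge0 //; first exact: ltW.
  rewrite -!nrm_sqr ler_sqr ?nnegrE ?nrm_ge0 //.
  by have := proj_nrm sI incI y; rewrite mul1r.
have e20 : 0 < e / 2 by lra.
have := form_bound_nrm sZ pZ e20 leZ w; rewrite ZI incI => hZ.
rewrite linearB linearZZ -cI -/w.
apply: le_trans (nrm_dist_triangle ((x i)%:C *: w) _ _) _.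
rewrite -scalerBl -rmorphB nrmZr (nrm_distC _ (A w)).
have : `|xi i - x i| * nrm w <= e / 2 * nrm w.
  rewrite ler_wpM2r ?nrm_ge0 // ger0_norm ?subr_ge0 //.
  by move: a2 a3; lra.
by move: hZ; lra.
Unshelve. all: by end_near.
Qed.

End SpectralTheorem.

(** * Spectral families *)

Section SpectralFamilies.
Context {R : realType} {H : hilbertType R}.
Implicit Types (u w v : H) (a b d e s t : R) (A X Y : {linear H -> H}).
Implicit Types (E : R -> {linear H -> H}) (x xi : nat -> R).

Lemma spectral_family_linear (E0 : R -> H -> H) : spectral_family E0 ->
  exists E, E0 = (fun s => E s).
Proof.
move=> [pE _ _ _].
have h s : exists F : {linear H -> H}, F = E0 s :> (H -> H).
  by have [[lE _] _ _] := pE s; apply: linear_fun_ex.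
by have [E hE] := choice h; exists E; apply/funext => s; rewrite hE.
Qed.

(** For [y] in the range of [E s], the order of the forms gives [|y|^2 <= (E t y, y)], while
    [|E t y - y|^2 = |y|^2 - (E t y, y)]. *)
Lemma spectral_family_chain E : spectral_family E -> projection_chain E.
Proof.
move=> [pE mE _ _].
have sE s : selfadj (E s) by have [_ _ h] := pE s; move=> u v; rewrite /ip h.
have iE s v : E s (E s v) = E s v.
  by have [_ h _] := pE s; exact: (congr1 (fun f => f v) h).
split => // s t st v; apply/subr0_eq/ip_eq0; set y := E s v.
have := mE _ _ st; rewrite op_leP // => /(_ y).
rewrite {1}/y iE -/y => h.
have -> : ip (E t y - y) (E t y - y) = ip y y - ip (E t y) y.
  rewrite !ipE -(sE t) iE (ipC y); ring.
apply/eqP; rewrite eq_le subr_le0 h subr_ge0 /=.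
rewrite -iE sE -nrm_sqr -nrm_sqr ler_sqr ?nnegrE ?nrm_ge0 //.
by have := proj_nrm (sE t) (iE t) y; rewrite mul1r.
Qed.

Lemma tagged_partition_le (E : R -> H -> H) d d' n x xi : d <= d' ->
  tagged_partition E d n x xi -> tagged_partition E d' n x xi.
Proof.
move=> dd [e0 en h]; split => // i /h[h1 h2 h3]; split => //.
exact: lt_le_trans h3 dd.
Qed.

Lemma fine_partition_ex (E : R -> H -> H) d : spectral_family E -> 0 < d ->
  exists n x xi, tagged_partition E d n x xi.
Proof.
move=> [_ _ _ [a [b [ha hb]]]] d0.
(* [E] vanishes only strictly below [a], hence the start at [a - 1]; the mesh must be strictly below
   [d], hence [d / 2]. *)
pose x i : R := a - 1 + i%:R * (d / 2).
have d20 : 0 < d / 2 by lra.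
have [n hn] : exists n : nat, (b - a + 1) / (d / 2) <= n%:R.
  exists (Num.bound `|(b - a + 1) / (d / 2)|).
  exact: ltW (le_lt_trans (ler_norm _) (archi_boundP (normr_ge0 _))).
exists n, x, x; split.
- by apply: ha; rewrite /x mul0r addr0 ltrBlDr ltrDl.
- by apply: hb; move: hn; rewrite ler_pdivrMr // /x; lra.
- by move=> i _; rewrite /x -(natr1 i) mulrDl; split; lra.
Qed.

Lemma integral_apply f E (B : H -> H) : spectral_integral f E B ->
  forall e, 0 < e -> exists2 d, 0 < d & forall n x xi, tagged_partition E d n x xi ->
    forall v, nrm (\sum_(i < n) (f (xi i))%:C *: inc E x i v - B v) <= e * nrm v.
Proof.
move=> h e e0; have [d d0 hd] := h e e0; exists d => // n x xi pE v.
by have := hd _ _ _ pE v; rewrite !normrE_nrm -rmorphM lecR.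
Qed.

Lemma inc_commuting E x i (X : H -> H) : (forall u v, X (u - v) = X u - X v) ->
  (forall s, commuting X (E s)) -> commuting X (inc E x i).
Proof. by move=> XB c v; rewrite !incE XB !c. Qed.

Lemma integral_commuting f E (B : H -> H) X : spectral_family E -> spectral_integral f E B ->
  bdd X -> (forall s, commuting X (E s)) -> commuting X B.
Proof.
move=> fE iB [M M0 bX] c v; apply/subr0_eq.
apply: (@nrm_small_mul_eq0 _ _ (nrm (X v) + M * nrm v)) => [|e e0].
  by rewrite addr_ge0 ?mulr_ge0 ?nrm_ge0 ?ltW.
have [d d0 hd] := integral_apply iB e0.
have [n [x [xi pE]]] := fine_partition_ex fE d0.
set S := fun v => \sum_(i < n) (f (xi i))%:C *: inc E x i v.
have SX : X (S v) = S (X v).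
  rewrite linear_sum; apply: eq_bigr => i _; rewrite linearZZ.
  by congr (_ *: _); apply: inc_commuting => // ? ?; rewrite linearB.
have -> : X (B v) - B (X v) = (S (X v) - B (X v)) - X (S v - B v).
  rewrite linearB SX; apply: ip_ext => z; rewrite !ipE; ring.
apply: le_trans (nrmB _ _) _.
have h1 := hd _ _ _ pE (X v); have h2 := le_trans (bX _) (ler_wpM2l (ltW M0) (hd _ _ _ pE v)).
by apply: le_trans (lerD h1 h2) _; rewrite mulrDr lerD2l mulrCA.
Qed.

Lemma integral_unique f E (B B' : H -> H) : spectral_family E ->
  spectral_integral f E B -> spectral_integral f E B' -> B = B'.
Proof.
move=> fE h h'; apply/funext => v; apply/subr0_eq.
apply: (@nrm_small_mul_eq0 _ _ (2 * nrm v)) => [|e e0]; first by rewrite mulr_ge0 ?nrm_ge0.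
have [d d0 hd] := integral_apply h e0.
have [d' d0' hd'] := integral_apply h' e0.
have dm : 0 < Num.min d d' by rewrite lt_min d0.
have [n [x [xi pE]]] := fine_partition_ex fE dm.
have dd : Num.min d d' <= d by rewrite ge_min lexx.
have dd' : Num.min d d' <= d' by rewrite ge_min lexx orbT.
have h1 := hd _ _ _ (tagged_partition_le dd pE) v.
have h2 := hd' _ _ _ (tagged_partition_le dd' pE) v.
apply: le_trans (nrm_dist_triangle (\sum_(i < n) (f (xi i))%:C *: inc E x i v) _ _) _.
by move: h1 h2; rewrite nrm_distC; lra.
Qed.

Section Resolution.
Variables (A : {linear H -> H}) (E : R -> {linear H -> H}).
Hypothesis rE : spectral_resolution A E.

Let fE : spectral_family E. Proof. by case: rE. Qed.
Let chE : projection_chain E := spectral_family_chain fE.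
Let nE s v : nrm (E s v) <= nrm v.
Proof. by have [sE iE _] := chE; have := proj_nrm (sE s) (iE s) v; rewrite mul1r. Qed.
Let bE s : bdd (E s). Proof. by exists 1 => // v; rewrite mul1r. Qed.

Lemma family_commuting s t : commuting (E s) (E t).
Proof.
move=> v; have [_ _ mE] := chE; have mE' := projection_chainC chE.
by have [st|/ltW st] := leP s t; rewrite (mE _ _ st) (mE' _ _ st).
Qed.

Lemma resolution_commuting s : commuting (E s) A.
Proof.
by apply: integral_commuting (proj2 rE) _ _ => // t; apply: family_commuting.
Qed.

(** In a Riemann sum for [A], a cell that does not kill [w] must meet the interval between [s] and
    [t], so its tag is within [t - s] plus the mesh of [c]. The mesh and the error of the sum then
    tend to zero. *)
Lemma cell_bound s t c v : s <= c <= t ->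
  nrm (A (E t v - E s v) - c%:C *: (E t v - E s v)) <= (t - s) * nrm (E t v - E s v).
Proof.
move=> /andP[sc ct]; set w := E t v - E s v.
have [sE iE mE] := chE; have mE' := projection_chainC chE.
apply: (@ler_addgt0_mulP _ _ _ (2 * nrm w)) => [|e e0]; first by rewrite mulr_ge0 ?nrm_ge0.
have [d d0 hd] := integral_apply (proj2 rE) e0.
have dm : 0 < Num.min d e by rewrite lt_min d0.
have [n [x [xi pE]]] := fine_partition_ex fE dm.
have dd : Num.min d e <= d by rewrite ge_min lexx.
have de : Num.min d e <= e by rewrite ge_min lexx orbT.
have h1 := hd _ _ _ (tagged_partition_le dd pE) w.
have {}pE := tagged_partition_le de pE; have [_ _ hx] := pE.
have rP := partition_resolution chE pE.
have h2 : nrm (\sum_(i < n) (id (xi i))%:C *: inc E x i w - c%:C *: w) <=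
    (t - s + e) * nrm w.
  have -> : \sum_(i < n) (id (xi i))%:C *: inc E x i w - c%:C *: w =
      \sum_(i < n) (xi i - c)%:C *: inc E x i w.
    rewrite -{2}(proj2 rP w) scaler_sumr -sumrB; apply: eq_bigr => i _.
    by apply: ip_ext => z; rewrite !ipE; ring.
  apply: (resolution_sum_bound rP); first by lra.
    by move=> i j ij; rewrite ipZl ipZr (proj1 rP) // !mulr0.
  move=> i; have [a1 a2 a3] := hx i (ltn_ord i).
  have [->|w0] := eqVneq (inc E x i w) 0.
    by rewrite scaler0 !nrm0 mulr0.
  rewrite nrmZr ler_wpM2r ?nrm_ge0 //.
  have xs : s < x i.+1.
    rewrite ltNge; apply: contra w0 => xs; apply/eqP.
    have xi0 : x i <= s by apply: le_trans xs; apply: le_trans a1 a2.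
    have st : s <= t := le_trans sc ct.
    rewrite incE /w ![E _ (_ - _)]linearB !mE' ?subrr //; exact: le_trans st.
  have xt : x i < t.
    rewrite ltNge; apply: contra w0 => tx; apply/eqP.
    have tx1 : t <= x i.+1 by apply: le_trans tx _; apply: le_trans a1 a2.
    have st : s <= t := le_trans sc ct.
    by rewrite incE /w ![E _ (_ - _)]linearB !mE ?subrr // (le_trans st).
  by rewrite ler_norml; apply/andP; split; lra.
apply: le_trans (nrm_dist_triangle (\sum_(i < n) (id (xi i))%:C *: inc E x i w) _ _) _.
by move: h1 h2; rewrite nrm_distC; lra.
Qed.

Section Commutation.
Variable X : {linear H -> H}.
Hypotheses (bX : bdd X) (cX : commuting X A).

(* On the range of [E s] resp. its complement, the powers of [A - a] grow at
   most like [(s - a) ^+ n], resp. at least like [(t - a) ^+ n]. *)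
Lemma off_diagonal_eq0 s t v : s < t -> X (E s v) - E t (X (E s v)) = 0.
Proof.
move=> st; have [_ _ _ [a' [b [ha hb]]]] := fE.
have [sE iE mE] := chE; have mE' := projection_chainC chE.
(* With [E a = 0] and [E b = 1], the ranges of [E s] and [1 - E t] become the cells from [a] to [s]
   and from [t] to [b], to which [cell_bound] applies. *)
pose a := a' - 1; have Ea : E a = op0 :> (H -> H) by apply: ha; rewrite ltrBlDr ltrDl.
have E0 u : E a u = 0 by rewrite Ea.
have [sa|sa] := leP s a.
  have -> : E s v = 0 by rewrite -(mE' _ _ sa) E0 linear0.
  by rewrite (linear0 X) (linear0 (E t)) subrr.
have [bt|bt] := leP b t.
  by rewrite (hb _ bt) subrr.
have [T TE] : exists T : {linear H -> H}, forall u, T u = A u - a%:C *: u.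
  by exists (A \- a%:C \*: idfun).
have [Y YE] : exists Y : {linear H -> H}, forall u, Y u = X (E s u) - E t (X (E s u)).
  by exists ((X \o E s) \- (E t \o (X \o E s))).
have lo u : nrm (T (E s u)) <= (s - a) * nrm (E s u).
  have := @cell_bound a s a u; rewrite lexx (ltW sa) E0 subr0 TE; exact.
have hi u : (t - a) * nrm (Y u) <= nrm (T (Y u)).
  have Eb w : E b w = w by rewrite hb.
  have := @cell_bound t b b (X (E s u)); rewrite lexx (ltW bt) Eb -YE => /(_ isT) h.
  have := nrm_dist_triangle (A (Y u)) (b%:C *: Y u) (a%:C *: Y u).
  rewrite -scalerBl -rmorphB nrmZr ger0_norm ?subr_ge0; last lra.
  by rewrite -TE nrm_distC; move: h; lra.
have TY u : T (Y u) = Y (T (E s u)).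
  have TX w : T (X w) = X (T w) by rewrite !TE [X (_ - _)]linearB [X (_ *: _)]linearZZ cX.
  have TEr r w : T (E r w) = E r (T w).
    by rewrite !TE [E r (_ - _)]linearB [E r (_ *: _)]linearZZ (resolution_commuting r).
  by rewrite !YE [T (_ - _)]linearB !(TEr, TX) iE.
have sa0 : 0 < s - a by rewrite subr_gt0.
have ta0 : 0 < t - a by rewrite subr_gt0 (lt_trans sa).
have [M M0 bY] : bdd Y.
  have [M M0 hM] := bX; exists (2 * M) => [|u]; first by rewrite mulr_gt0.
  rewrite YE; apply: le_trans (nrmB _ _) _; have := nE t (X (E s u)).
  by have := le_trans (hM (E s u)) (ler_wpM2l (ltW M0) (nE s u)); lra.
(* [T = A - a] passes through [Y] and acts on the range of [E s]: each use trades a factor [t - a]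
   on the left for [s - a] on the right. The ratio is below 1, which forces [Y = 0]. *)
have pw n u : (t - a) ^+ n * nrm (Y u) <= M * ((s - a) ^+ n * nrm u).
  elim: n u => [|n IH] u; first by rewrite !expr0 !mul1r.
  rewrite !exprSr -mulrA; apply: le_trans (ler_wpM2l (exprn_ge0 _ (ltW ta0)) (hi u)) _.
  rewrite TY; apply: le_trans (IH _) _; rewrite ler_pM2l // -mulrA.
  apply: ler_wpM2l; first by rewrite exprn_ge0 // ltW.
  by apply: le_trans (lo u) _; rewrite ler_wpM2l // ltW.
rewrite -YE; apply: (@nrm_small_mul_eq0 _ _ (M * nrm v)) => [|e e0].
  by rewrite mulr_ge0 ?nrm_ge0 ?ltW.
pose q := (s - a) / (t - a).
have q0 : 0 <= q by rewrite divr_ge0 // ltW.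
have q1 : `|q| < 1 by rewrite ger0_norm // ltr_pdivrMr // mul1r ltrD2r.
have /cvgrPdist_le/(_ _ e0)[N _ /(_ N (leqnn N))] := cvg_expr q1.
rewrite /= sub0r normrN normrX (ger0_norm q0) => hN.
have tN : 0 < (t - a) ^+ N by rewrite exprn_gt0.
rewrite -(ler_pM2l tN); apply: le_trans (pw N v) _.
move: hN; rewrite expr_div_n ler_pdivrMr // => hN.
have -> : (t - a) ^+ N * (e * (M * nrm v)) = M * (e * (t - a) ^+ N * nrm v) by ring.
by rewrite ler_pM2l // ler_wpM2r // nrm_ge0.
Qed.

(** The off-diagonal argument needs a gap [s < t]; right continuity closes it. *)
Lemma range_invariant s v : E s (X (E s v)) = X (E s v).
Proof.
set u := X (E s v); have Et t : s < t -> E t u = u.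
  by move=> st; apply/esym/subr0_eq; apply: off_diagonal_eq0.
apply/subr0_eq/nrm_small_eq0 => e e0.
have [_ _ /(_ s u)/cvgrPdist_le rc _] := fE.
have e0' : 0 < e%:C by rewrite ltcR.
have : \forall t \near s^'+, s < t /\ `|E s u - E t u| <= e%:C.
  near=> t; split; near: t; [exact: nbhs_right_gt | exact: rc].
by move=> /filter_ex[t [/Et-> ]]; rewrite normrE_nrm lecR.
Unshelve. all: by end_near.
Qed.

(** Taking adjoints in [E X E = X E] gives [E X E = E X]. *)
Lemma resolution_bicommutant s : selfadj X -> commuting X (E s).
Proof.
have [sE iE mE] := chE; move=> sX v; apply: ip_ext => z.
by rewrite -range_invariant sE sX sE range_invariant -sX sE.
Qed.

End Commutation.

End Resolution.

End SpectralFamilies.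

(** * Continuous functions on a segment *)

Section RealContinuity.
Context {R : realType}.
Variables (f : R -> R) (p q : R).
Hypotheses (pq : p <= q) (fc : forall t, p <= t -> {for t, continuous f}).

Lemma segment_within_continuous : {within `[p, q], continuous f}.
Proof.
apply: continuous_in_subspaceT => t.
by rewrite inE /= in_itv /= => /andP[pt _]; apply: fc.
Qed.

Lemma segment_bound_ex : exists2 L, 0 < L & forall t, p <= t <= q -> `|f t| <= L.
Proof.
have cf := segment_within_continuous.
have [c1 _ h1] := EVT_max pq cf; have [c2 _ h2] := EVT_min pq cf.
exists (`|f c1| + `|f c2| + 1); first by rewrite ltr_wpDl // addr_ge0.
move=> t pt; have tI : t \in `[p, q] by rewrite in_itv.
have := h1 t tI; have := h2 t tI; have := ler_norm (f c1).
have := lerNnormlW (lexx `|f c2|); have := normr_ge0 (f c1); have := normr_ge0 (f c2).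
by move=> *; rewrite ler_norml; apply/andP; split; lra.
Qed.

Lemma segment_min_gt0_ex : (forall t, p <= t -> 0 < f t) ->
  exists2 c, 0 < c & forall t, p <= t <= q -> c <= f t.
Proof.
move=> f0; have [c cI hc] := EVT_min pq segment_within_continuous.
exists (f c); first by apply: f0; move: cI; rewrite in_itv => /andP[].
by move=> t pt; apply: hc; rewrite in_itv.
Qed.

(** Only [s] is confined to the segment; [t] need only stay above [p]. This fits the joint sums,
    where a quotient of tags is compared with a tag known to lie in the segment. *)
Lemma segment_unif_continuous e : 0 < e -> exists2 d, 0 < d &
  forall s t, p <= s <= q -> p <= t -> `|s - t| <= d -> `|f s - f t| <= e.
Proof.
move=> e0; have e20 : 0 < e / 2 by lra.
pose P (d : R) (s : R) := forall t, p <= t -> `|s - t| <= d -> `|f s - f t| <= e.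
have /compact_near_coveringP/(_ R (0^'+) P) := @segment_compact R p q.
case.
  move=> s /=; rewrite in_itv /= => /andP[ps _].
  have /cvgrPdist_le/(_ _ e20)/nbhs_ballP[r /= r0 hr] := fc ps.
  have r20 : 0 < r / 2 by lra.
  exists (ball s (r / 2), [set d | d < r / 2]).
    split => /=; first exact: nbhsx_ballx.
    exact: nbhs_right_lt.
  move=> [s' d] /= [h1 h2] t pt h3.
  have h4 : `|s - s'| < r / 2 by [].
  have := hr s' _; have := hr t _; rewrite /ball /= => h5 h6.
  have {}h6 := h6 (lt_trans h4 _); have {}h5 : `|f s - f t| <= e / 2.
    apply: h5; have := ler_distD s' s t; lra.
  have := ler_distD (f s) (f s') (f t); rewrite (distrC (f s') (f s)).
  have /h6 : r / 2 < r by lra.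
  by move: h5; lra.
move=> r /= r0 hr; exists (r / 2); first lra.
have hP : `[p, q]%classic `<=` P (r / 2).
  apply: hr => /=; last lra.
  by rewrite sub0r normrN ger0_norm; lra.
by move=> s t sI; apply: hP; rewrite /= in_itv.
Qed.

End RealContinuity.

(** * Functional calculus *)

Section EigenResolutions.
Context {R : realType} {H : hilbertType R}.
Implicit Types (u w v : H) (a b c d e s t : R) (A B X Y : {linear H -> H}).
Implicit Types (E : R -> {linear H -> H}) (x xi : nat -> R).

(** Forgets the partition and keeps approximate eigenspaces, so that conjugated families fit too.
    The tag of a zero piece is unconstrained. *)
Definition eigen_resolution A (I : finType) (P : I -> {linear H -> H}) (xi : I -> R) d :=
  [/\ identity_resolution P, forall i, commuting A (P i) &
      forall i v, nrm (A (P i v) - (xi i)%:C *: P i v) <= d * nrm (P i v)].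

Lemma partition_eigen_resolution A E d n x xi : spectral_resolution A E ->
  tagged_partition E d n x xi ->
  eigen_resolution A (fun i : 'I_n => inc E x i) (fun i => xi i) d.
Proof.
move=> rE pE; have [fE _] := rE; have chE := spectral_family_chain fE.
have [_ _ hx] := pE; split; first exact: partition_resolution chE pE.
  move=> i; apply: inc_commuting => [u v|s v]; first by rewrite linearB.
  by rewrite (resolution_commuting rE).
move=> i v; have [a1 a2 a3] := hx i (ltn_ord i).
have /(_ v) := @cell_bound _ _ _ _ rE (x i) (x i.+1) (xi i).
rewrite a1 a2 => /(_ isT) /le_trans; apply.
by rewrite ler_wpM2r ?nrm_ge0 // ltW.
Qed.

(** Tags may lie outside the spectrum, even where nothing is known of [f]; a nonzero piece forces
    its tag back near [[m, K]]. *)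
Lemma approx_eigenvalue_bounds A m K c d w :
  (forall v, m * ip v v <= ip (A v) v) -> (forall v, nrm (A v) <= K * nrm v) ->
  nrm (A w - c%:C *: w) <= d * nrm w -> w != 0 -> m - d <= c <= K + d.
Proof.
move=> hm hK h w0.
have n0 : 0 < nrm w.
  by rewrite lt_neqAle nrm_ge0 andbT eq_sym; apply: contra w0 => /eqP/nrm_eq0 ->.
apply/andP; split.
  rewrite -(ler_pM2r (exprn_gt0 2 n0)) mulrBl.
  have := le_trans (CauchySchwarz_ip _ _) (ler_wpM2r (nrm_ge0 w) h).
  rewrite ipDl ipNl ipZl; have := hm w; rewrite -!nrm_sqr; lra.
rewrite -(ler_pM2r n0) mulrDl.
have := nrm_dist_triangle (A w) (c%:C *: w) 0.
rewrite !subr0 nrmZr nrm_distC; have := hK w; have := ler_wpM2r (nrm_ge0 w) (ler_norm c).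
by move: h; lra.
Qed.

Lemma eigenvalue_dist A c c' d d' w :
  nrm (A w - c%:C *: w) <= d * nrm w -> nrm (A w - c'%:C *: w) <= d' * nrm w ->
  w != 0 -> `|c - c'| <= d + d'.
Proof.
move=> h h' w0.
have n0 : 0 < nrm w.
  by rewrite lt_neqAle nrm_ge0 andbT eq_sym; apply: contra w0 => /eqP/nrm_eq0 ->.
rewrite -(ler_pM2r n0) -nrmZr rmorphB scalerBl.
apply: le_trans (nrm_dist_triangle (A w) _ _) _.
by rewrite nrm_distC mulrDl lerD.
Qed.

Lemma scaled_resolution_bound (I : finType) (P : I -> {linear H -> H}) (c : I -> R) e v :
  identity_resolution P -> 0 <= e -> (forall i, P i v != 0 -> `|c i| <= e) ->
  nrm (\sum_i (c i)%:C *: P i v) <= e * nrm v.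
Proof.
move=> rP e0 hc; apply: (resolution_sum_bound rP) => //.
  by move=> i j ij; rewrite ipZl ipZr (proj1 rP) // !mulr0.
move=> i; have [->|w0] := eqVneq (P i v) 0; first by rewrite scaler0 nrm0 mulr0.
by rewrite nrmZr ler_wpM2r ?nrm_ge0 // hc.
Qed.

Section FunctionalCalculus.
Variables (A : {linear H -> H}) (E : R -> {linear H -> H}) (f : R -> R) (m K : R).
Hypotheses (m0 : 0 < m) (hm : forall v, m * ip v v <= ip (A v) v).
Hypotheses (K0 : 0 < K) (hK : forall v, nrm (A v) <= K * nrm v).
Hypotheses (f0 : forall t, 0 < t -> 0 < f t) (fc : forall t, 0 < t -> {for t, continuous f}).
Hypothesis rE : spectral_resolution A E.

Let fE : spectral_family E. Proof. by case: rE. Qed.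
Let chE : projection_chain E := spectral_family_chain fE.

Lemma tag_range c d w : d <= 1 -> d <= m / 2 ->
  nrm (A w - c%:C *: w) <= d * nrm w -> w != 0 -> m / 2 <= c <= m + K + 1.
Proof.
move=> d1 dm h w0; have := approx_eigenvalue_bounds hm hK h w0.
have := m0; move=> ? /andP[? ?]; apply/andP; split; lra.
Qed.

Lemma half_le : m / 2 <= m + K + 1. Proof. by have := m0; have := K0; lra. Qed.

Lemma half_fc t : m / 2 <= t -> {for t, continuous f}.
Proof. by move=> h; apply: fc; apply: lt_le_trans h; have := m0; lra. Qed.

Definition riemann_sum n x xi v := \sum_(i < n) (f (xi i))%:C *: inc E x i v.

(** On a nonzero piece of the common refinement both tags are approximate eigenvalues of [A], hence
    at distance at most [2 d]; this explains the bound [dl / 2]. *)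
Lemma riemann_sums_close e : 0 < e -> exists2 d, 0 < d &
  forall n x xi, tagged_partition E d n x xi ->
  forall n' x' xi', tagged_partition E d n' x' xi' ->
  forall v, nrm (riemann_sum n x xi v - riemann_sum n' x' xi' v) <= e * nrm v.
Proof.
move=> e0; have [dl dl0 hdl] := segment_unif_continuous (m + K + 1) half_fc e0.
pose d := Num.min (dl / 2) (Num.min 1 (m / 2)).
have d0 : 0 < d by rewrite !lt_min ltr01 !divr_gt0.
have d1 : d <= 1 by rewrite !ge_min lexx orbT.
have d2 : d <= m / 2 by rewrite !ge_min lexx !orbT.
have d3 : d <= dl / 2 by rewrite !ge_min lexx.
exists d => // n x xi pE n' x' xi' pE' v.
have [rP cP aP] := partition_eigen_resolution rE pE.
have [rQ cQ aQ] := partition_eigen_resolution rE pE'.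
have cPQ (i : 'I_n) (j : 'I_n') : commuting (inc E x i) (inc E x' j).
  apply: inc_commuting => [u w|s w]; first by rewrite linearB.
  symmetry; apply: inc_commuting => [y z|t z]; first by rewrite linearB.
  exact: family_commuting rE _ _ _.
have rPQ := resolution_mul rP rQ cPQ.
have -> : riemann_sum n x xi v - riemann_sum n' x' xi' v =
    \sum_(ij : 'I_n * 'I_n') (f (xi ij.1) - f (xi' ij.2))%:C *:
       inc E x ij.1 (inc E x' ij.2 v).
  rewrite -(pair_bigA _ (fun i j : 'I__ => (f (xi i) - f (xi' j))%:C *:
       (inc E x i (inc E x' j v)))) /=.
  rewrite (_ : riemann_sum n x xi v =
    \sum_(i < n) \sum_(j < n') (f (xi i))%:C *: inc E x i (inc E x' j v)); last first.
    by apply: eq_bigr => i _; rewrite -scaler_sumr -linear_sum (proj2 rQ).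
  rewrite (_ : riemann_sum n' x' xi' v =
    \sum_(i < n) \sum_(j < n') (f (xi' j))%:C *: inc E x i (inc E x' j v)); last first.
    rewrite exchange_big; apply: eq_bigr => j _ /=.
    by rewrite -scaler_sumr (proj2 rP).
  rewrite -sumrB; apply: eq_bigr => i _; rewrite -sumrB; apply: eq_bigr => j _.
  by rewrite rmorphB scalerBl.
pose PQ (ij : 'I_n * 'I_n') : {linear H -> H} := inc E x ij.1 \o inc E x' ij.2.
apply: (@scaled_resolution_bound _ PQ) => //; first exact: ltW.
move=> [i j] /= w0.
have h1 := aP i (inc E x' j v).
have := aQ j (inc E x i v); rewrite -cPQ => h2.
apply: hdl; first exact: tag_range h1 w0.
  by have /andP[] := tag_range d1 d2 h2 w0.
by apply: le_trans (eigenvalue_dist h1 h2 w0) _; lra.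
Qed.

Lemma riemann_sum_linear n x xi : exists S : {linear H -> H},
  forall v, S v = riemann_sum n x xi v.
Proof.
have lS : linear (riemann_sum n x xi).
  move=> k u v; rewrite /riemann_sum scaler_sumr -big_split; apply: eq_bigr => i _.
  have -> : inc E x i (k *: u + v) = k *: inc E x i u + inc E x i v by rewrite linearP.
  by rewrite scalerDr [k *: (_ *: _)]scalerA mulrC -scalerA.
by have [S SE] := linear_fun_ex lS; exists S => v; rewrite SE.
Qed.

Lemma riemann_sum_bound : exists2 L, 0 < L & forall d n x xi, d <= 1 -> d <= m / 2 ->
  tagged_partition E d n x xi -> forall v, nrm (riemann_sum n x xi v) <= L * nrm v.
Proof.
have [L L0 hL] := segment_bound_ex half_le half_fc.
exists L => // d n x xi d1 d2 pE v.
have [rP cP aP] := partition_eigen_resolution rE pE.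
apply: scaled_resolution_bound => //; first exact: ltW.
by move=> i w0; apply: hL; apply: tag_range (aP i v) w0.
Qed.

Lemma spectral_integral_ex : exists2 B : {linear H -> H}, bdd B & spectral_integral f E B.
Proof.
have [L L0 hL] := riemann_sum_bound.
pose d n := Num.min (n.+1%:R^-1) (Num.min 1 (m / 2)) : R.
have d0 n : 0 < d n by rewrite !lt_min ltr01 invr_gt0 divr_gt0 //= ltr0Sn.
have d1 n : d n <= 1 by rewrite !ge_min lexx orbT.
have d2 n : d n <= m / 2 by rewrite !ge_min lexx !orbT.
have d3 e : 0 < e -> exists N, forall n, (N <= n)%N -> d n <= e.
  move=> e0; have [N hN] := ltr_add_invr e0; exists N => n Nn.
  rewrite !ge_min (le_trans _ (ltW hN)) // add0r lef_pV2 ?posrE // ler_nat ltnS //.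
have hp n : exists S : {linear H -> H}, exists k x xi,
    tagged_partition E (d n) k x xi /\ forall v, S v = riemann_sum k x xi v.
  have [k [x [xi pE]]] := fine_partition_ex fE (d0 n).
  by have [S hS] := riemann_sum_linear k x xi; exists S, k, x, xi.
have [S hS] := choice hp.
have bS n v : nrm (S n v) <= L * nrm v.
  by have [k [x [xi [pE ->]]]] := hS n; apply: hL pE _.
(* The comparison is with every fine partition: it yields both the Cauchy property of [S] and the
   convergence of all Riemann sums to its limit. *)
have close e : 0 < e -> exists2 d', 0 < d' & exists N, forall n, (N <= n)%N ->
    forall k x xi, tagged_partition E d' k x xi ->
    forall v, nrm (S n v - riemann_sum k x xi v) <= e * nrm v.
  move=> e0; have [d' d0' hd] := riemann_sums_close e0; exists d' => //.
  have [N hN] := d3 _ d0'; exists N => n /hN dn k x xi pE v.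
  have [k' [x' [xi' [pE' ->]]]] := hS n; apply: hd pE v.
  exact: tagged_partition_le pE'.
have lS v : exists l : H, (fun n => S n v) @ \oo --> l.
  apply: nrm_complete => e e0.
  have v1 : 0 < nrm v + 1 by rewrite ltr_wpDl // nrm_ge0.
  have [d' d0' [N hN]] := close _ (divr_gt0 e0 v1).
  have [N' hN'] := d3 _ d0'.
  exists (maxn N N') => i j; rewrite !geq_max => /andP[Ni _] /andP[_ Nj].
  have [k [x [xi [pE ->]]]] := hS j.
  apply: le_trans (hN _ Ni _ _ _ (tagged_partition_le (hN' _ Nj) pE) v) _.
  by rewrite -mulrA ger_pMr // mulrC ler_pdivrMr // mul1r lerDl.
have [B bB hB] := strong_limit bS lS.
exists B; first by exists L.
move=> e e0; have [d' d0' [N hN]] := close e e0; exists d' => // k x xi pE v.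
rewrite !normrE_nrm -rmorphM lecR nrm_distC.
rewrite -/(riemann_sum k x xi v).
have hs : (fun n => S (n + N)%N v - riemann_sum k x xi v) @ \oo --> B v - riemann_sum k x xi v.
  apply: cvgB; last exact: cvg_cst.
  by have := hB v; rewrite -(cvg_shiftn N).
apply: cvg_nrm_le hs _ => n; apply: hN => //; exact: leq_addl.
Qed.

Lemma spectral_integral_form B : bdd B -> spectral_integral f E B ->
  selfadj B /\ exists2 c, 0 < c & forall v, c * ip v v <= ip (B v) v.
Proof.
move=> bB iB; split.
  move=> u v; apply/subr0_eq/eqP; rewrite -normr_le0.
  apply: (@ler_addgt0_mulP _ _ _ (2 * (nrm u * nrm v))) => [|e e0].
    by rewrite !mulr_ge0 ?nrm_ge0.
  have [d d0 hd] := integral_apply iB e0.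
  have [n [x [xi pE]]] := fine_partition_ex fE d0.
  have sS : ip (riemann_sum n x xi u) v = ip u (riemann_sum n x xi v).
    rewrite ip_suml ip_sumr; apply: eq_bigr => i _.
    by rewrite ipZl ipZr (inc_selfadj _ _ chE).
  have h1 := hd _ _ _ pE u; have h2 := hd _ _ _ pE v.
  have -> : ip (B u) v - ip u (B v) =
      ip u (riemann_sum n x xi v - B v) - ip (riemann_sum n x xi u - B u) v.
    by rewrite !ipDl !ipDr !ipNl !ipNr sS; ring.
  apply: le_trans (ler_normB _ _) _; rewrite add0r.
  have g1 := le_trans (abs_ip _ _) (ler_wpM2l (nrm_ge0 u) h2).
  have g2 := le_trans (abs_ip _ _) (ler_wpM2r (nrm_ge0 v) h1).
  by apply: le_trans (lerD g1 g2) _; rewrite le_eqVlt; apply/orP; left; apply/eqP; ring.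
have half_f0 t : m / 2 <= t -> 0 < f t.
  by move=> h; apply: f0; apply: lt_le_trans h; have := m0; lra.
have [c c0 hc] := segment_min_gt0_ex half_le half_fc half_f0.
exists c => // v; apply: (@ler_addgt0_mulP _ _ _ (ip v v)) => [|e e0]; first exact: ip_ge0.
have [d d0 hd] := integral_apply iB e0.
pose d' := Num.min d (Num.min 1 (m / 2)).
have d0' : 0 < d' by rewrite !lt_min ltr01 d0 divr_gt0.
have d1 : d' <= 1 by rewrite !ge_min lexx orbT.
have d2 : d' <= m / 2 by rewrite !ge_min lexx !orbT.
have d3 : d' <= d by rewrite !ge_min lexx.
have [n [x [xi pE]]] := fine_partition_ex fE d0'.
have [rP cP aP] := partition_eigen_resolution rE pE.
have h1 := hd _ _ _ (tagged_partition_le d3 pE) v.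
have h2 : c * ip v v <= ip (riemann_sum n x xi v) v.
  rewrite ip_suml -[X in ip X v](proj2 rP v) ip_suml mulr_sumr.
  apply: ler_sum => i _; rewrite ipZl.
  have [->|w0] := eqVneq (inc E x i v) 0; first by rewrite ip0l !mulr0.
  have -> : ip (inc E x i v) v = ip (inc E x i v) (inc E x i v).
    rewrite -[X in ip _ X = _](proj2 rP v) ip_sumr (bigD1 i) //= big1 ?addr0 //.
    by move=> j ji; rewrite (proj1 rP) // eq_sym.
  by rewrite ler_wpM2r ?ip_ge0 //; apply: hc; apply: tag_range (aP i v) w0.
have := le_trans (CauchySchwarz_ip _ v) (ler_wpM2r (nrm_ge0 v) h1).
by rewrite ipDl ipNl -mulrA -expr2 nrm_sqr -/(riemann_sum n x xi v); move: h2; lra.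
Qed.

End FunctionalCalculus.

(** The constructed resolution only shows that the choice in [fun_op] is not vacuous; the [E]
    returned is the one attached to the chosen value. *)
Lemma fun_op_spec A (f : R -> R) m K : selfadj A -> 0 < m -> (forall v, m * ip v v <= ip (A v) v) ->
  0 < K -> (forall v, nrm (A v) <= K * nrm v) ->
  (forall t, 0 < t -> 0 < f t) -> (forall t, 0 < t -> {for t, continuous f}) ->
  exists E (B : {linear H -> H}), [/\ fun_op f A = B, spectral_resolution A E, spectral_integral f E B &
    [/\ bdd B, selfadj B & exists2 c, 0 < c & forall v, c * ip v v <= ip (B v) v]].
Proof.
move=> sA m0 hm K0 hK f0 fc.
have bA : bdd A by exists K.
have [E rE] := spectral_resolution_ex sA bA.
have [B bB iB] := spectral_integral_ex m0 hm K0 hK fc rE.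
pose S := [set B : H -> H | exists E : R -> H -> H, spectral_resolution A E /\ spectral_integral f E B].
have hex : exists B : H -> H, S B by exists B, (fun s => E s).
have : S (fun_op f A) := xgetPex op0 hex.
case=> E0 [rE0 iE0]; have [F FE] := spectral_family_linear (proj1 rE0).
rewrite FE in rE0 iE0.
have [B' bB' iB'] := spectral_integral_ex m0 hm K0 hK fc rE0.
have [sB' cB'] := spectral_integral_form m0 hm K0 hK f0 fc rE0 bB' iB'.
exists F, B'; split => //.
exact: integral_unique (proj1 rE0) iE0 iB'.
Qed.

End EigenResolutions.

(** * Joint Riemann sums *)

Section JointSums.
Context {R : realType} {H : hilbertType R}.
Implicit Types (u w v : H) (d e s t : R).
Variables (A B C : {linear H -> H}) (f : R -> R) (m K mC KC : R).
Hypotheses (m0 : 0 < m) (hm : forall v, m * ip v v <= ip (A v) v).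
Hypotheses (K0 : 0 < K) (hK : forall v, nrm (A v) <= K * nrm v).
Hypotheses (mC0 : 0 < mC) (hmC : forall v, mC * ip v v <= ip (C v) v).
Hypotheses (KC0 : 0 < KC) (hKC : forall v, nrm (C v) <= KC * nrm v).
Hypothesis CA : forall v, C (A v) = B v.
Hypothesis fc : forall t, 0 < t -> {for t, continuous f}.

(* [(a c - b) w = (B - b) w - C (A - a) w - a (C - c) w], as [B = C A]. *)
Lemma joint_eigenvalue_ratio a b c d w : w != 0 -> 0 < a ->
  nrm (A w - a%:C *: w) <= d * nrm w -> nrm (B w - b%:C *: w) <= d * nrm w ->
  nrm (C w - c%:C *: w) <= d * nrm w ->
  `|c - b / a| <= (1 + (KC + 1) / a) * d.
Proof.
move=> w0 a0 hA hB hC.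
have n0 : 0 < nrm w.
  by rewrite lt_neqAle nrm_ge0 andbT eq_sym; apply: contra w0 => /eqP/nrm_eq0 ->.
have e1 : (a * c - b)%:C *: w =
    (B w - b%:C *: w) - (C (A w - a%:C *: w) + a%:C *: (C w - c%:C *: w)).
  rewrite [C (_ - _)]linearB [C (_ *: _)]linearZZ CA.
  by apply: ip_ext => z; rewrite !ipE; ring.
have h : `|a * c - b| * nrm w <= (d + (KC * d + a * d)) * nrm w.
  rewrite -nrmZr e1; apply: le_trans (nrmB _ _) _.
  rewrite mulrDl lerD // mulrDl; apply: le_trans (nrmD _ _) (lerD _ _).
    by apply: le_trans (hKC _) _; rewrite -mulrA ler_pM2l.
  by rewrite nrmZr gtr0_norm // -mulrA ler_pM2l.
have {}h : `|a * c - b| <= d + (KC * d + a * d) by rewrite -(ler_pM2r n0).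
have an0 : a != 0 by rewrite gt_eqF.
have -> : c - b / a = (a * c - b) / a by field.
rewrite normrM normfV (gtr0_norm a0) ler_pdivrMr //.
by apply: le_trans h _; rewrite le_eqVlt; apply/orP; left; apply/eqP; field.
Qed.

Lemma joint_sum_close e : 0 < e -> exists2 d0, 0 < d0 &
  forall (I J L : finType) (P : I -> {linear H -> H}) (Q : J -> {linear H -> H})
    (G : L -> {linear H -> H}) xi eta zeta d, 0 < d -> d <= d0 ->
  eigen_resolution A P xi d -> eigen_resolution B Q eta d -> eigen_resolution C G zeta d ->
  (forall i j, commuting (P i) (Q j)) -> (forall i k, commuting (P i) (G k)) ->
  (forall j k, commuting (Q j) (G k)) ->
  (forall j, commuting A (Q j)) -> (forall k, commuting A (G k)) ->
  forall v, nrm (\sum_i \sum_j (xi i * f (eta j / xi i))%:C *: P i (Q j v)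
    - A (\sum_k (f (zeta k))%:C *: G k v)) <= e * nrm v.
Proof.
(* Tags of [C] on nonzero pieces are at least [mC / 2 = 2 p], so quotients within [p] of them stay
   above [p]. *)
move=> e0; pose p := mC / 4; pose q := mC + KC + 1.
have pq : p <= q by rewrite /p /q; have := mC0; have := KC0; lra.
have p0 : 0 < p by rewrite divr_gt0.
have fcp t : p <= t -> {for t, continuous f} by move=> pt; apply: fc; apply: lt_le_trans pt.
have [L0 L00 hL] := segment_bound_ex pq fcp.
pose Xi := m + K + 1; have Xi0 : 0 < Xi by rewrite /Xi; have := m0; have := K0; lra.
have [dl dl0 hdl] := segment_unif_continuous q fcp (divr_gt0 e0 (mulr_gt0 (ltr0n R 2) Xi0)).
(* The factor of [joint_eigenvalue_ratio] at the least possible tag [m / 2] of [A]. *)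
pose kap := 1 + (KC + 1) / (m / 2).
have kap0 : 0 < kap by rewrite ltr_pwDl // divr_ge0 // ?divr_ge0 ?addr_ge0 // ltW.
pose d0 := Num.min (Num.min (e / (2 * L0)) (Num.min 1 (m / 2)))
  (Num.min (mC / 2) (Num.min (dl / kap) (p / kap))).
have d00 : 0 < d0 by rewrite !lt_min ltr01 !divr_gt0 // mulr_gt0.
exists d0 => // I J L P Q G xi eta zeta d dpos.
rewrite !le_min => /andP[/and3P[dL d1 dm] /and3P[dC dd dp]].
move=> [rP cAP aP] [rQ cBQ aQ] [rG cCG aG] cPQ cPG cQG cAQ cAG v.
pose PQ (ij : I * J) : {linear H -> H} := P ij.1 \o Q ij.2.
have rPQ : identity_resolution PQ by apply: resolution_mul rP rQ cPQ.
pose W (x : (I * J) * L) : {linear H -> H} := PQ x.1 \o G x.2.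
have rW : identity_resolution W.
  by apply: resolution_mul rPQ rG _ => ij k u /=; rewrite cQG cPG.
have AW x u : A (W x u) = W x (A u) by rewrite /= cAP cAQ cAG.
pose phi (ij : I * J) := xi ij.1 * f (eta ij.2 / xi ij.1).
pose V (x : (I * J) * L) := (phi x.1)%:C *: W x v - (f (zeta x.2))%:C *: A (W x v).
have -> : \sum_i \sum_j (xi i * f (eta j / xi i))%:C *: P i (Q j v)
    - A (\sum_k (f (zeta k))%:C *: G k v) = \sum_x V x.
  rewrite sumrB; congr (_ - _).
    rewrite (pair_bigA _ (fun i j => (xi i * f (eta j / xi i))%:C *: P i (Q j v))) /=.
    rewrite -(pair_bigA _ (fun ij k => (phi ij)%:C *: PQ ij (G k v))) /=.
    apply: eq_bigr => ij _.
    have {1}-> : v = \sum_k G k v by rewrite (proj2 rG).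
    by rewrite -scaler_sumr -!linear_sum.
  rewrite -(pair_bigA _ (fun ij k => (f (zeta k))%:C *: A (PQ ij (G k v)))) /=.
  rewrite exchange_big /= linear_sum; apply: eq_bigr => k _.
  by rewrite -scaler_sumr -linear_sum (proj2 rPQ) linearZZ.
apply: (resolution_sum_bound rW); first exact: ltW.
  move=> x y xy; have VE z : V z = W z ((phi z.1)%:C *: v - (f (zeta z.2))%:C *: A v).
    by rewrite /V AW [RHS]linearB [W z (_ *: v)]linearZZ [W z (_ *: A v)]linearZZ.
  by rewrite !VE (proj1 rW).
move=> [[i j] k]; rewrite /V /phi; set w := W _ v => /=.
have [->|w0] := eqVneq w 0; first by rewrite [A 0]linear0 !scaler0 subrr nrm0 mulr0.
have hA : nrm (A w - (xi i)%:C *: w) <= d * nrm w by apply: aP.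
have hB : nrm (B w - (eta j)%:C *: w) <= d * nrm w by rewrite /w /= cPQ; apply: aQ.
have hC : nrm (C w - (zeta k)%:C *: w) <= d * nrm w.
  by rewrite /w /= cQG cPG; apply: aG.
have /andP[xi1 xi2] := tag_range m0 hm hK d1 dm hA w0.
have m20 : 0 < m / 2 by rewrite divr_gt0.
have xi0 : 0 < xi i := lt_le_trans m20 xi1.
have /andP[z1 z2] := tag_range mC0 hmC hKC d1 dC hC w0.
have ratio : `|zeta k - eta j / xi i| <= kap * d.
  apply: le_trans (joint_eigenvalue_ratio w0 xi0 hA hB hC) _.
  rewrite ler_pM2r // lerD2l ler_pM2l; last by rewrite addr_gt0.
  by rewrite lef_pV2 ?posrE.
have hp : kap * d <= p by rewrite mulrC -ler_pdivlMr.
have hd : kap * d <= dl by rewrite mulrC -ler_pdivlMr.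
have pz : p <= zeta k by apply: le_trans z1; rewrite /p; have := mC0; lra.
have pe : p <= eta j / xi i.
  have : 2 * p <= zeta k by apply: le_trans z1; rewrite /p; lra.
  by move: ratio hp; rewrite ler_norml => /andP[_ ?] ? ?; lra.
have df : `|f (zeta k) - f (eta j / xi i)| <= e / (2 * Xi).
  by apply: hdl => //; [rewrite pz|apply: le_trans hd].
(* The error splits into the variation of [f], scaled by [xi i <= Xi], and the defect of [A] on the
   piece, scaled by [|f| <= L0]; each gets [e / 2]. *)
have -> : (xi i * f (eta j / xi i))%:C *: w - (f (zeta k))%:C *: A w =
    (xi i * (f (eta j / xi i) - f (zeta k)))%:C *: w -
    (f (zeta k))%:C *: (A w - (xi i)%:C *: w).
  by apply: ip_ext => z; rewrite !ipE; ring.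
apply: le_trans (nrmB _ _) _; rewrite !nrmZr normrM (gtr0_norm xi0) distrC.
have g1 : xi i * `|f (zeta k) - f (eta j / xi i)| * nrm w <= e / 2 * nrm w.
  rewrite ler_wpM2r ?nrm_ge0 //.
  apply: le_trans (_ : _ <= Xi * (e / (2 * Xi))) _.
    by apply: ler_pM => //; apply: ltW.
  by rewrite le_eqVlt; apply/orP; left; apply/eqP; field; rewrite gt_eqF.
have fz : `|f (zeta k)| <= L0 by apply: hL; rewrite pz.
have g2 : `|f (zeta k)| * nrm (A w - (xi i)%:C *: w) <= e / 2 * nrm w.
  apply: le_trans (ler_pM _ _ fz hA) _; rewrite ?nrm_ge0 // mulrA ler_wpM2r ?nrm_ge0 //.
  move: dL; rewrite ler_pdivlMr ?mulr_gt0 //; lra.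
by move: g1 g2; lra.
Qed.

End JointSums.

(** * Identification of the chosen operators and of the mean *)

Section OperatorMeans.
Context {R : realType} {H : hilbertType R}.
Implicit Types (u w v x y : H) (d e s t : R) (A Ai B C S V X Y : {linear H -> H}).

Lemma sqrt_opE A S : selfadj S -> form_ge0 S -> bdd S -> (forall v, S (S v) = A v) ->
  sqrt_op A = S.
Proof.
move=> sS pS bS SS.
pose Q := [set S' : H -> H | positive_op S' /\ S' \o S' = A].
have hex : exists S' : H -> H, Q S'.
  by exists S; split; [exact: positive_op_linear|exact/funext].
have [pT TT] : Q (sqrt_op A) := xgetPex op0 hex.
have [T [TE bT sT pT']] := positive_opP pT.
rewrite -TE in TT *; apply/funext => v; apply: pos_sqrt_unique => // w.
by rewrite SS -TT.
Qed.

Lemma inv_opE S V : bdd V -> (forall v, S (V v) = v) -> (forall v, V (S v) = v) ->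
  inv_op S = V.
Proof.
move=> bV SV VS.
have hV : inverse_of S V by split; [exact: bounded_op_linear|exact/funext|exact/funext].
have [_ h1 _] : inverse_of S (inv_op S) := xgetI op0 hV.
apply/funext => v; rewrite -{1}(SV v).
exact: (congr1 (fun f => f (V v)) h1).
Qed.

Lemma adjointE A B : bdd B -> (forall x y, ip (A x) y = ip x (B y)) -> adjoint A = B.
Proof.
move=> bB AB.
have hAB x y : hdot (A x) y = hdot x (B y).
  apply/eqP; rewrite eq_complex !Im_hdot -!/(ip _ _) AB eqxx /=.
  by rewrite AB linearZZ.
pose Q := [set S : H -> H | bounded_op S /\ forall x y, hdot (A x) y = hdot x (S y)].
have [_ h] : Q (adjoint A) := xgetI op0 (conj (bounded_op_linear bB) hAB : Q B).
apply/funext => y; apply: ip_ext => z.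
by rewrite ipC [RHS]ipC /ip -h hAB.
Qed.

Lemma mean_data_ex A Ai B (f : R -> R) m K :
  selfadj A -> form_ge0 A -> bdd A -> bdd Ai ->
  (forall v, A (Ai v) = v) -> (forall v, Ai (A v) = v) ->
  selfadj B -> 0 < m -> (forall v, m * ip v v <= ip (B v) v) ->
  0 < K -> (forall v, nrm (B v) <= K * nrm v) ->
  (forall t, 0 < t -> 0 < f t) -> (forall t, 0 < t -> {for t, continuous f}) ->
  exists (S V C F : {linear H -> H}) (G : R -> {linear H -> H}) (mC KC : R),
  [/\ [/\ op_mean f A B = S \o F \o S, selfadj S, bdd S &
         forall X, bdd X -> commuting X A -> commuting X S],
      [/\ forall v, S (S v) = A v, forall v, S (V v) = v, forall v, V (S v) = v,
         bdd V & forall v, C v = V (B (V v))],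
      [/\ selfadj C, 0 < mC /\ (forall v, mC * ip v v <= ip (C v) v),
         0 < KC /\ (forall v, nrm (C v) <= KC * nrm v), spectral_resolution C G &
         spectral_integral f G F] &
      [/\ bdd F, selfadj F & exists2 c, 0 < c & forall v, c * ip v v <= ip (F v) v]].
Proof.
move=> sA pA bA [KAi KAi0 bAi] AAi AiA sB m0 hm K0 hK f0 fc.
have [S [sS pS [KS KS0 bS] SS cS]] := pos_sqrt_ex sA pA bA.
pose V : {linear H -> H} := S \o Ai.
have SV v : S (V v) = v by rewrite /= SS.
have SA v : S (A v) = A (S v) by rewrite -!SS.
have AiS v : Ai (S v) = S (Ai v) by rewrite -{1}(AAi v) SA AiA.
have VS v : V (S v) = v by rewrite /= AiS SS.
have bV : bdd V by apply: bdd_comp; [exists KS|exists KAi].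
have sV : selfadj V by move=> x y; rewrite -{1}(SV y) -sS SV.
have [KV KV0 hV] := bV.
pose C : {linear H -> H} := V \o B \o V.
have CE v : C v = V (B (V v)) by [].
have sC : selfadj C by move=> x y; rewrite !CE !sV sB sV.
have KS2 : 0 < KS ^+ 2 by rewrite exprn_gt0.
(* [(C v, v) = (B V v, V v) >= m |V v|^2], and [|v| = |S V v| <= KS |V v|]. *)
have mC0 : 0 < m / KS ^+ 2 by rewrite divr_gt0.
have hmC v : m / KS ^+ 2 * ip v v <= ip (C v) v.
  rewrite CE sV; apply: le_trans (hm (V v)).
  rewrite -mulrA ler_pM2l // mulrC ler_pdivrMr // mulrC -!nrm_sqr -exprMn.
  rewrite ler_sqr ?nnegrE ?mulr_ge0 ?nrm_ge0 ?(ltW KS0) //.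
  by rewrite -{1}(SV v).
have KC0 : 0 < KV * (K * KV) by rewrite !mulr_gt0.
have hKC v : nrm (C v) <= KV * (K * KV) * nrm v.
  rewrite CE; apply: le_trans (hV _) _; rewrite -mulrA ler_pM2l //.
  by apply: le_trans (hK _) _; rewrite -mulrA ler_pM2l.
have [G [F [fF rG iF pF]]] := fun_op_spec sC mC0 hmC KC0 hKC f0 fc.
exists S, V, C, F, G, (m / KS ^+ 2), (KV * (K * KV)).
have bS' : bdd S by exists KS.
split => //; split => //.
by rewrite /op_mean (sqrt_opE sS pS bS' SS) (inv_opE bV SV VS) -fF.
Qed.

Lemma doi_unique (phi : R -> R -> R) (E F : R -> H -> H) (X : H -> H) (D D' : H -> H) :
  spectral_family E -> spectral_family F ->
  double_operator_integral phi E X F D -> double_operator_integral phi E X F D' -> D = D'.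
Proof.
move=> fE fF h h'; apply/funext => v; apply/subr0_eq.
apply: (@nrm_small_mul_eq0 _ _ (2 * nrm v)) => [|e e0]; first by rewrite mulr_ge0 ?nrm_ge0.
have [d d0 hd] := h _ e0; have [d' d0' hd'] := h' _ e0.
have dm : 0 < Num.min d d' by rewrite lt_min d0.
have dd : Num.min d d' <= d by rewrite ge_min lexx.
have dd' : Num.min d d' <= d' by rewrite ge_min lexx orbT.
have [n [x [xi pE]]] := fine_partition_ex fE dm.
have [k [y [eta pF]]] := fine_partition_ex fF dm.
have := hd _ _ _ (tagged_partition_le dd pE) _ _ _ (tagged_partition_le dd pF) v.
have := hd' _ _ _ (tagged_partition_le dd' pE) _ _ _ (tagged_partition_le dd' pF) v.
set Z := (\sum_(i < n) _); rewrite !normrE_nrm -rmorphM !lecR => h1 h2.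
apply: le_trans (nrm_dist_triangle Z _ _) _.
by move: h1 h2; rewrite (nrm_distC (D v)); lra.
Qed.

End OperatorMeans.

(** * The induced Aluthge transformation *)

Section InducedAluthge.
Context {R : realType} {H : hilbertType R}.
Implicit Types (u w v : H) (d e s t : R) (X Y : {linear H -> H}).
Implicit Types (E : R -> {linear H -> H}) (x y xi eta : nat -> R) (D : H -> H).
Variables (P Pi U W : {linear H -> H}) (f : R -> R) (m K : R).
Hypotheses (sP : selfadj P) (m0 : 0 < m) (hm : forall v, m * ip v v <= ip (P v) v).
Hypotheses (K0 : 0 < K) (hK : forall v, nrm (P v) <= K * nrm v).
Hypotheses (bPi : bdd Pi) (PPi : forall v, P (Pi v) = v) (PiP : forall v, Pi (P v) = v).
Hypotheses (UW : forall v, U (W v) = v) (WU : forall v, W (U v) = v).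
Hypothesis ipW : forall u v, ip (W u) v = ip u (U v).
Hypotheses (f0 : forall t, 0 < t -> 0 < f t) (fc : forall t, 0 < t -> {for t, continuous f}).

Lemma nrm_U v : nrm (U v) = nrm v.
Proof. by apply/eqP; rewrite -(@eqrXn2 _ 2) ?nrm_ge0 // !nrm_sqr -ipW WU. Qed.

Lemma nrm_W v : nrm (W v) = nrm v. Proof. by rewrite -nrm_U UW. Qed.

Definition conj_abs : {linear H -> H} := W \o P \o U.
Local Notation A := conj_abs.

Lemma conj_absE v : A v = W (P (U v)). Proof. by []. Qed.

Lemma conj_abs_selfadj : selfadj A.
Proof. by move=> x y; rewrite !conj_absE ipW sP [RHS]ipC ipW ipC. Qed.

Lemma conj_abs_form v : m * ip v v <= ip (A v) v.
Proof. by rewrite conj_absE ipW -(nrm_sqr v) -nrm_U nrm_sqr hm. Qed.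

Lemma conj_abs_bound v : nrm (A v) <= K * nrm v.
Proof. by rewrite conj_absE nrm_W -(nrm_U v) hK. Qed.

Lemma doi_of_nrm E D : (forall e, 0 < e -> exists2 d, 0 < d &
    forall n x xi, tagged_partition E d n x xi ->
    forall k y eta, tagged_partition E d k y eta -> forall v,
    nrm (\sum_(i < n) \sum_(j < k) (xi i * f (eta j / xi i))%:C *:
      inc E x i (U (inc E y j v)) - D v) <= e * nrm v) ->
  double_operator_integral (fun s t => s * f (t / s)) (fun s => E s) U (fun s => E s) D.
Proof.
move=> h e e0; have [d d0 hd] := h _ e0; exists d => // n x xi pE k y eta pF v.
by rewrite !normrE_nrm -rmorphM lecR; apply: hd.
Qed.

(** The affine formula for [f] is available only at positive arguments; tags that fail this sit on
    zero cells. *)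
Lemma tag_gt0 (B : {linear H -> H}) mB KB E d n (x xi : nat -> R) i v :
  0 < mB -> (forall v, mB * ip v v <= ip (B v) v) -> (forall v, nrm (B v) <= KB * nrm v) ->
  spectral_resolution B E -> d <= mB / 2 -> tagged_partition E d n x xi ->
  (i < n)%N -> inc E x i v != 0 -> 0 < xi i.
Proof.
move=> mB0 hmB hKB rE dm pE iN w0.
have [_ _ aP] := partition_eigen_resolution rE pE.
have := approx_eigenvalue_bounds hmB hKB (aP (Ordinal iN) v) w0.
by move=> /andP[h _]; move: h dm; rewrite /=; have := mB0; lra.
Qed.

Lemma affine_integral (B : {linear H -> H}) mB KB E l : 0 <= l <= 1 ->
  (forall t, 0 < t -> f t = 1 - l + l * t) ->
  0 < mB -> (forall v, mB * ip v v <= ip (B v) v) -> (forall v, nrm (B v) <= KB * nrm v) ->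
  spectral_resolution B E ->
  spectral_integral f E (fun v => (1 - l)%:C *: v + l%:C *: B v).
Proof.
move=> /andP[l0 l1] fl mB0 hmB hKB rE e e0.
have chE := spectral_family_chain (proj1 rE).
have [d d0 hd] := integral_apply (proj2 rE) e0.
exists (Num.min d (mB / 2)); first by rewrite lt_min d0 divr_gt0.
move=> n x xi pE v.
have dd : Num.min d (mB / 2) <= d by rewrite ge_min lexx.
have dm : Num.min d (mB / 2) <= mB / 2 by rewrite ge_min lexx orbT.
have h := hd _ _ _ (tagged_partition_le dd pE) v.
have rP := partition_resolution chE pE.
rewrite !normrE_nrm -rmorphM lecR.
have -> : \sum_(i < n) (f (xi i))%:C *: increment (fun s => E s) x i v =
    (1 - l)%:C *: v + l%:C *: \sum_(i < n) (xi i)%:C *: inc E x i v.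
  rewrite -{2}(proj2 rP v) !scaler_sumr -big_split; apply: eq_bigr => i _.
  rewrite -[increment _ _ _ _]/(inc E x i v).
  have [->|w0] := eqVneq (inc E x i v) 0; first by rewrite /= !scaler0 addr0.
  rewrite fl; last exact: (tag_gt0 mB0 hmB hKB rE dm pE (ltn_ord i) w0).
  by apply: ip_ext => z; rewrite !ipE; ring.
set Z := \sum_(i < n) _ in h *.
have -> : (1 - l)%:C *: v + l%:C *: Z - ((1 - l)%:C *: v + l%:C *: B v) = l%:C *: (Z - B v).
  by apply: ip_ext => z; rewrite !ipE; ring.
rewrite nrmZr ger0_norm //; apply: le_trans h.
by rewrite -[leRHS]mul1r ler_wpM2r ?nrm_ge0.
Qed.

(** [s f (t / s) = (1 - l) s + l t] separates the variables: in each term one of the two sums of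
    increments is the identity. *)
Lemma affine_doi E l : 0 <= l <= 1 ->
  (forall t, 0 < t -> f t = 1 - l + l * t) -> spectral_resolution P E ->
  double_operator_integral (fun s t => s * f (t / s)) (fun s => E s) U (fun s => E s)
    (fun v => (1 - l)%:C *: P (U v) + l%:C *: U (P v)).
Proof.
move=> /andP[l0 l1] fl rE; apply: doi_of_nrm => e e0.
have chE := spectral_family_chain (proj1 rE).
have [d d0 hd] := integral_apply (proj2 rE) e0.
exists (Num.min d (m / 2)); first by rewrite lt_min d0 divr_gt0.
move=> n x xi pE k y eta pF v.
have dd : Num.min d (m / 2) <= d by rewrite ge_min lexx.
have dm : Num.min d (m / 2) <= m / 2 by rewrite ge_min lexx orbT.
have h1 := hd _ _ _ (tagged_partition_le dd pE) (U v).
have h2 := hd _ _ _ (tagged_partition_le dd pF) v.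
have rP := partition_resolution chE pE.
have rQ := partition_resolution chE pF.
rewrite nrm_U in h1.
have -> : \sum_(i < n) \sum_(j < k) (xi i * f (eta j / xi i))%:C *:
      inc E x i (U (inc E y j v)) =
    (1 - l)%:C *: (\sum_(i < n) (xi i)%:C *: inc E x i (U v)) +
    l%:C *: U (\sum_(j < k) (eta j)%:C *: inc E y j v).
  transitivity (\sum_(i < n) \sum_(j < k)
     ((1 - l)%:C *: ((xi i)%:C *: inc E x i (U (inc E y j v))) +
      l%:C *: ((eta j)%:C *: inc E x i (U (inc E y j v))))).
    apply: eq_bigr => i _; apply: eq_bigr => j _.
    have [->|w0] := eqVneq (inc E x i (U (inc E y j v))) 0.
      by rewrite !scaler0 addr0.
    have xi0 := tag_gt0 m0 hm hK rE dm pE (ltn_ord i) w0.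
    have w0' : inc E y j v != 0.
      by apply: contra w0 => /eqP ->; rewrite [U 0]linear0 linear0.
    have eta0 := tag_gt0 m0 hm hK rE dm pF (ltn_ord j) w0'.
    rewrite fl ?divr_gt0 //; apply: ip_ext => z; rewrite !ipE; field.
    by rewrite gt_eqF.
  have e1 i : \sum_(j < k) (1 - l)%:C *: ((xi i)%:C *: inc E x i (U (inc E y j v))) =
      (1 - l)%:C *: ((xi i)%:C *: inc E x i (U v)).
    by rewrite -!scaler_sumr -!linear_sum (proj2 rQ).
  have e2 j : \sum_(i < n) l%:C *: ((eta j)%:C *: inc E x i (U (inc E y j v))) =
      l%:C *: U ((eta j)%:C *: inc E y j v).
    by rewrite -!scaler_sumr (proj2 rP) [U (_ *: _)]linearZZ.
  under eq_bigr do rewrite big_split e1.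
  rewrite big_split; congr (_ + _); first by rewrite -scaler_sumr.
  rewrite exchange_big; under eq_bigr do rewrite e2.
  by rewrite -scaler_sumr -linear_sum.
set Z1 := \sum_(i < n) _ in h1 *; set Z2 := \sum_(j < k) _ in h2 *.
have -> : (1 - l)%:C *: Z1 + l%:C *: U Z2 - ((1 - l)%:C *: P (U v) + l%:C *: U (P v)) =
    (1 - l)%:C *: (Z1 - P (U v)) + l%:C *: U (Z2 - P v).
  by rewrite [U (_ - _)]linearB; apply: ip_ext => z; rewrite !ipE; ring.
apply: le_trans (nrmD _ _) _; rewrite !nrmZr nrm_U !ger0_norm ?subr_ge0 //.
have l10 : 0 <= 1 - l by rewrite subr_ge0.
apply: le_trans (lerD (ler_wpM2l l10 h1) (ler_wpM2l l0 h2)) _.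
by rewrite -mulrDl subrK mul1r.
Qed.

Section Binormal.
Hypothesis bin : forall v, P (U (P (W v))) = U (P (W (P v))).
Variable E : R -> {linear H -> H}.
Hypothesis rE : spectral_resolution P E.

Let fE : spectral_family E. Proof. by case: rE. Qed.
Let chE : projection_chain E := spectral_family_chain fE.
Let sE s : selfadj (E s). Proof. by case: chE. Qed.
Let bE s : bdd (E s).
Proof. by have [s1 i1 _] := chE; exists 1 => // v; apply: proj_nrm. Qed.

Definition conj_family s : {linear H -> H} := W \o E s \o U.

Lemma conj_familyE s v : conj_family s v = W (E s (U v)). Proof. by []. Qed.

Lemma conj_family_selfadj s : selfadj (conj_family s).
Proof. by move=> x y; rewrite !conj_familyE ipW sE [RHS]ipC ipW ipC. Qed.

Lemma conj_family_bdd s : bdd (conj_family s).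
Proof.
have [M M0 hM] := bE s; exists M => // v.
by rewrite conj_familyE nrm_W -(nrm_U v) hM.
Qed.

(** [X = U P W] is the absolute value of the adjoint of [T]. Binormality makes it commute with [P],
    hence with [E s]; conjugating by [U] gives the claim. *)
Lemma conj_family_commuting_abs s : commuting P (conj_family s).
Proof.
move=> v; rewrite !conj_familyE.
pose X : {linear H -> H} := U \o P \o W.
have XE u : X u = U (P (W u)) by [].
have sX : selfadj X by move=> x y; rewrite !XE ipC -ipW ipC sP ipW.
have bX : bdd X.
  by exists K => // u; rewrite XE nrm_U -(nrm_W u) hK.
have cX : commuting X P by move=> u; rewrite !XE bin.
have := resolution_bicommutant rE bX cX s sX (U v); rewrite !XE WU => h.
by rewrite -h WU.
Qed.

Lemma conj_family_commuting_conj_abs s : commuting (conj_family s) A.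
Proof. by move=> v; rewrite !conj_familyE !conj_absE !UW (resolution_commuting rE). Qed.

(** A second use of the bicommutant property, now for the self-adjoint operator [conj_family s]. *)
Lemma conj_family_commuting s t : commuting (conj_family s) (E t).
Proof.
apply: (resolution_bicommutant rE (conj_family_bdd s)); last exact: conj_family_selfadj.
by move=> v; rewrite conj_family_commuting_abs.
Qed.

Lemma conj_abs_commuting : commuting P A.
Proof. by move=> v; rewrite !conj_absE -[LHS]WU -bin WU. Qed.

Lemma conj_abs_commuting_family t : commuting A (E t).
Proof.
apply: (resolution_bicommutant rE); last exact: conj_abs_selfadj.
  by exists K => // v; apply: conj_abs_bound.
by move=> v; rewrite conj_abs_commuting.
Qed.

Lemma conj_partition_eigen d n x xi : tagged_partition E d n x xi ->
  eigen_resolution A (fun i : 'I_n => inc conj_family x i) (fun i => xi i) d.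
Proof.
move=> pE; have [[oP sumP] cP aP] := partition_eigen_resolution rE pE.
have IE (i : 'I_n) v : inc conj_family x i v = W (inc E x i (U v)).
  by rewrite !incE [RHS]linearB.
split; first split.
- by move=> i j ij u v; rewrite !IE ipW UW oP.
- move=> v; under eq_bigr do rewrite IE.
  by rewrite -linear_sum sumP WU.
- by move=> i v; rewrite !IE !conj_absE !UW cP.
- move=> i v; rewrite IE conj_absE UW -linearZZ -linearB !nrm_W; exact: aP.
Qed.

End Binormal.

End InducedAluthge.

Section AluthgeMean.
Context {R : realType} {H : hilbertType R}.
Implicit Types (u w v : H) (d e s t : R) (X Y M : {linear H -> H}).
Variables (P Pi U W : {linear H -> H}) (f : R -> R) (m K : R).
Hypotheses (sP : selfadj P) (m0 : 0 < m) (hm : forall v, m * ip v v <= ip (P v) v).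
Hypotheses (K0 : 0 < K) (hK : forall v, nrm (P v) <= K * nrm v).
Hypotheses (bPi : bdd Pi) (PPi : forall v, P (Pi v) = v) (PiP : forall v, Pi (P v) = v).
Hypotheses (UW : forall v, U (W v) = v) (WU : forall v, W (U v) = v).
Hypothesis ipW : forall u v, ip (W u) v = ip u (U v).
Hypotheses (f0 : forall t, 0 < t -> 0 < f t) (fc : forall t, 0 < t -> {for t, continuous f}).
Hypothesis cases : arithmetic_representing f \/
  (forall v, P (U (P (W v))) = U (P (W (P v)))).

Local Notation A := (conj_abs P U W).

(** The double integral is treated for every resolution [E] of [P], because the one behind [aluthge]
    is unspecified. *)
Lemma aluthge_mean_ex : exists M,
  [/\ op_mean f A P = M, bdd M /\ selfadj M, form_ge0 M, forall v, M v = 0 -> v = 0 &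
      forall E : R -> {linear H -> H}, spectral_resolution P E ->
      double_operator_integral (fun s t => s * f (t / s)) E U E (U \o M)].
Proof.
have sA := conj_abs_selfadj sP ipW.
have hA := conj_abs_form hm WU ipW.
have bA v : nrm (A v) <= K * nrm v := conj_abs_bound hK UW WU ipW v.
have nU := nrm_U WU ipW; have nW := nrm_W UW WU ipW.
have pA : form_ge0 A.
  by move=> v; apply: le_trans (hA v); rewrite mulr_ge0 ?ip_ge0 // ltW.
have bdA : bdd A by exists K.
pose Ai : {linear H -> H} := W \o Pi \o U.
have AAi v : A (Ai v) = v by rewrite conj_absE /= UW PPi WU.
have AiA v : Ai (A v) = v by rewrite conj_absE /= UW PiP WU.
have bAi : bdd Ai.
  have [N N0 hN] := bPi; exists N => // v.
  by rewrite /= nW -(nU v) hN.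
have [S [V [C [F [G [mC [KC [[ME sS bS cS] [SS SV VS bV CE]
  [sC [mC0 hmC] [KC0 hKC] rG iF] [bF sF [c c0 hc]]]]]]]]]] :=
  mean_data_ex sA pA bdA bAi AAi AiA sP m0 hm K0 hK f0 fc.
pose M : {linear H -> H} := S \o F \o S.
have MvE v : M v = S (F (S v)) by [].
have fG := proj1 rG; have chG := spectral_family_chain fG.
exists M; split => //.
- split; first exact: bdd_comp (bdd_comp bS bF) bS.
  by move=> u v; rewrite !MvE sS sF sS.
- by move=> v; rewrite MvE sS; apply: le_trans (hc _); rewrite mulr_ge0 ?ip_ge0 // ltW.
- move=> v Mv; have : ip (F (S v)) (S v) = 0 by rewrite -sS -MvE Mv ip0l.
  move=> h; have := hc (S v); rewrite h pmulr_rle0 // => h'.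
  have Sv : S v = 0 by apply: ip_eq0; apply/eqP; rewrite eq_le h' ip_ge0.
  by rewrite -(VS v) Sv linear0.
move=> E rE; case: cases => [[l l01 fl]|bin].
  (* Thus [F = (1 - l) + l C], and [S C S = P] turns [S F S] into [(1 - l) A + l P]. *)
  have iF' := affine_integral l01 fl mC0 hmC hKC rG.
  have FE := integral_unique fG iF iF'.
  have -> : (U \o M : H -> H) = (fun v => (1 - l)%:C *: P (U v) + l%:C *: U (P v)).
    apply/funext => v; rewrite /= FE /=.
    rewrite [S (_ + _)]linearD ![S (_ *: _)]linearZZ SS CE SV VS conj_absE.
    by rewrite [U (_ + _)]linearD ![U (_ *: _)]linearZZ UW.
  exact: (affine_doi m0 hm hK WU ipW l01 fl rE).
have fE := proj1 rE; have chE := spectral_family_chain fE.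
have [sE iE _] := chE.
have bE s : bdd (E s) by exists 1 => // v; apply: proj_nrm.
have bP : bdd P by exists K.
have cPA := conj_abs_commuting WU bin.
have SP v : S (P v) = P (S v) by symmetry; apply: cS.
(* [V P V S S = V P S = V S P = P], as [S] commutes with [P]. *)
have CA v : C (A v) = P v by rewrite CE -SS VS -SP VS.
have VX X : commuting X S -> commuting X V.
  by move=> c' v; rewrite -{2}(SV v) c' VS.
have CX X : commuting X S -> commuting X P -> commuting X C.
  by move=> c1 c2 v; rewrite !CE (VX _ c1) c2 (VX _ c1).
pose Y := conj_family U W E.
have sY s : selfadj (Y s) := conj_family_selfadj ipW rE s.
have bY s : bdd (Y s) := conj_family_bdd UW WU ipW rE s.
have cYA s : commuting (Y s) A := conj_family_commuting_conj_abs UW rE s.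
have cYP s : commuting (Y s) P.
  by move=> v; rewrite (conj_family_commuting_abs sP K0 hK UW WU ipW bin rE).
have cYE s t : commuting (Y s) (E t) := conj_family_commuting sP K0 hK UW WU ipW bin rE s t.
have cAE t : commuting A (E t) := conj_abs_commuting_family sP K0 hK UW WU ipW bin rE t.
have cEC t : commuting (E t) C.
  apply: CX; last exact: resolution_commuting rE t.
  by apply: cS => // v; rewrite cAE.
have cYC s : commuting (Y s) C by apply: CX => //; apply: cS.
have cEG t r : commuting (E t) (G r) := resolution_bicommutant rG (bE t) (cEC t) r (sE t).
have cYG s r : commuting (Y s) (G r) := resolution_bicommutant rG (bY s) (cYC s) r (sY s).
have cAG r : commuting A (G r).
  apply: (resolution_bicommutant rG bdA) => //; apply: CX => // v.
  by apply: cS.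
have cSF : commuting S F.
  apply: (integral_commuting fG iF bS) => r.
  apply: (resolution_bicommutant rG bS) => //; apply: CX => // v.
have MA v : M v = A (F v) by rewrite MvE -cSF SS.
apply: (doi_of_nrm (D := U \o M)) => e e0.
have e20 : 0 < e / 2 by lra.
have [d1 d10 hd1] := joint_sum_close m0 hA K0 bA mC0 hmC KC0 hKC CA fc e20.
(* [A] enlarges the error of the sum for [F] by at most [K]. *)
have [d2 d20 hd2] := integral_apply iF (divr_gt0 e20 K0).
exists d1 => // n x xi pE k y eta pF v.
have dm : 0 < Num.min d1 d2 by rewrite lt_min d10.
(* An auxiliary partition: its sum [Z] links the double sum to [A (F v)] and then disappears. *)
have [k' [z [zeta pG]]] := fine_partition_ex fG dm.
have dd1 : Num.min d1 d2 <= d1 by rewrite ge_min lexx.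
have dd2 : Num.min d1 d2 <= d2 by rewrite ge_min lexx orbT.
have h2 := hd2 _ _ _ (tagged_partition_le dd2 pG) v.
have pG1 := tagged_partition_le dd1 pG.
have ciL (D : R -> {linear H -> H}) z' i X :
    (forall s, commuting (D s) X) -> commuting (inc D z' i) X.
  by move=> c' u; rewrite !incE !c' [RHS]linearB.
have ciR (D : R -> {linear H -> H}) z' i X :
    (forall s, commuting X (D s)) -> commuting X (inc D z' i).
  by move=> c'; apply: inc_commuting => // a b; rewrite linearB.
have h1 := hd1 _ _ _ _ _ _ _ _ _ d1 d10 (lexx _)
  (conj_partition_eigen UW WU ipW rE pE)
  (partition_eigen_resolution rE pF) (partition_eigen_resolution rG pG1)
  (fun i j => ciL Y x i _ (fun s => ciR E y j _ (cYE s)))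
  (fun i r => ciL Y x i _ (fun s => ciR G z r _ (cYG s)))
  (fun j r => ciL E y j _ (fun s => ciR G z r _ (cEG s)))
  (fun j => ciR E y j _ cAE) (fun r => ciR G z r _ cAG) v.
set Z := \sum_(r < k') _ in h1.
have -> : \sum_(i < n) \sum_(j < k) (xi i * f (eta j / xi i))%:C *:
      inc E x i (U (inc E y j v)) =
    U (\sum_(i < n) \sum_(j < k) (xi i * f (eta j / xi i))%:C *: inc Y x i (inc E y j v)).
  rewrite linear_sum; apply: eq_bigr => i _; rewrite linear_sum; apply: eq_bigr => j _.
  move: (inc E y j v) => w.
  by rewrite [U (_ *: _)]linearZZ (incE Y) /Y !conj_familyE [U (_ - _)]linearB !UW.
have -> : (U \o M) v = U (A (F v)) by rewrite -MA.
rewrite -linearB nU.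
apply: le_trans (nrm_dist_triangle (A Z) _ _) _.
rewrite -linearB.
have h3 := le_trans (bA (Z - F v)) (ler_wpM2l (ltW K0) h2).
apply: le_trans (lerD h1 h3) _.
by rewrite mulrA mulrCA divff ?gt_eqF // mulr1 -mulrDl -splitr.
Qed.

End AluthgeMean.

Lemma arithmetic_representing_gt0 (R : realType) (f : R -> R) :
  arithmetic_representing f -> forall t, 0 < t -> 0 < f t.
Proof.
move=> [l /andP[l0 l1] fl] t t0; rewrite fl //.
have [->|ln0] := eqVneq l 0; first by rewrite subr0 mul0r addr0.
by rewrite ltr_wpDl ?subr_ge0 // mulr_gt0 // lt_neqAle eq_sym ln0.
Qed.

Lemma arithmetic_representing_continuous (R : realType) (f : R -> R) :
  arithmetic_representing f -> forall t, 0 < t -> {for t, continuous f}.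
Proof.
move=> [l /andP[l0 l1] fl] t t0; apply/cvgrPdist_le => e e0.
near=> s.
have s0 : 0 < s by near: s; exact: lt_nbhsr.
have h : `|t - s| <= e by near: s; apply: (@cvgr_dist_le _ _ _ _ _ id).
rewrite !fl // opprD addrACA subrr add0r -mulrBr normrM ger0_norm //.
by apply: le_trans h; rewrite -[leRHS]mul1r ler_wpM2r.
Unshelve. all: by end_near.
Qed.

(** * Polar decomposition of an invertible operator *)

Section PolarDecomposition.
Context {R : realType} {H : hilbertType R}.

(** The junk value is positive as well, so [abs_op T] is positive before any adjoint of [T] has been
    exhibited. *)
Lemma sqrt_op_positive (A : H -> H) : positive_op (sqrt_op A).
Proof.
rewrite /sqrt_op; case: xgetP => [S _ []//|_].
have op0E : op0 = (\0 : {linear H -> H}) :> (H -> H) by [].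
rewrite op0E; apply: positive_op_linear => [||v]; last by rewrite ip0l.
  by exists 1 => // v; rewrite nrm0 mulr_ge0 ?nrm_ge0.
by move=> u v; rewrite ip0l ip0r.
Qed.

Lemma nrm_isometry_ip (U : {linear H -> H}) : (forall v, nrm (U v) = nrm v) ->
  forall u v, ip (U u) (U v) = ip u v.
Proof.
move=> nU u v; have q w : ip (U w) (U w) = ip w w by rewrite -!nrm_sqr nU.
have := q (u + v); rewrite linearD !ipDl !ipDr !q (ipC (U v)) (ipC v); lra.
Qed.

(* The unitary factor of an invertible operator, and the bounded inverses of
   both factors, are read off [T = U P] and [V = T^-1]. *)
Lemma invertible_polar_data (T U0 : H -> H) : invertible_op T ->
  polar_decomposition T U0 (abs_op T) ->
  exists (P Pi U W : {linear H -> H}) (m K : R),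
  [/\ [/\ U0 = U, abs_op T = P, bdd U & bdd W],
      [/\ selfadj P, 0 < m /\ (forall v, m * ip v v <= ip (P v) v) &
        0 < K /\ (forall v, nrm (P v) <= K * nrm v)],
      [/\ bdd Pi, forall v, P (Pi v) = v & forall v, Pi (P v) = v] &
      [/\ forall v, U (W v) = v, forall v, W (U v) = v &
        forall u v, ip (W u) v = ip u (U v)]].
Proof.
move=> [bT [V0 [bV0 V0T TV0]]] [TE _ [bU0 iU0] kU0].
have [V VE bV] := bounded_opP bV0; have [U UE bU] := bounded_opP bU0.
have [P [PE bP sP pP]] := positive_opP (sqrt_op_positive (adjoint T \o T)).
rewrite -/(abs_op T) in PE.
have TUP v : T v = U (P v) by rewrite TE UE PE.
have VT v : V (T v) = v by rewrite VE; exact: (congr1 (fun g => g v) V0T).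
have TV v : T (V v) = v by rewrite VE; exact: (congr1 (fun g => g v) TV0).
have T0 v : T v = 0 -> v = 0 by move=> h; rewrite -(VT v) h linear0.
have kU v : U v = 0 -> v = 0 by rewrite UE => /kU0/T0.
(* The kernel of [U] is zero, so every vector is orthogonal to it. *)
have nU v : nrm (U v) = nrm v.
  rewrite /nrm UE iU0 // => y; rewrite -UE => /kU ->.
  by rewrite linear0r.
pose W : {linear H -> H} := P \o V.
pose Pi : {linear H -> H} := V \o U.
have UW v : U (W v) = v by rewrite /= -TUP TV.
have WU v : W (U v) = v.
  by apply/subr0_eq/kU; rewrite linearB UW subrr.
have PPi v : P (Pi v) = v by apply: WU.
have PiP v : Pi (P v) = v by rewrite /= -TUP VT.
have bPi : bdd Pi by apply: bdd_comp.
have [N N0 hN] := bPi; have [K K0 hK] := bP.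
(* Source of the lower bound: [|v|^2 = |Pi P v|^2 <= N^2 (P v, P v) <= N^2 K1 (P v, v)]. *)
have [K1 K10 hK1] := bdd_form_bound_sqr sP pP bP.
have N2 : 0 < N ^+ 2 * K1 by rewrite mulr_gt0 // exprn_gt0.
exists P, Pi, U, W, (N ^+ 2 * K1)^-1, K; split; split => //.
- exact: bdd_comp.
- split; first by rewrite invr_gt0.
  move=> v; rewrite mulrC ler_pdivrMr // mulrC -mulrA.
  apply: le_trans (ler_wpM2l _ (hK1 v)); last by rewrite exprn_ge0 // ltW.
  rewrite -!nrm_sqr -exprMn ler_sqr ?nnegrE ?mulr_ge0 ?nrm_ge0 ?(ltW N0) //.
  by rewrite -{1}(PiP v).
- by move=> u v; rewrite -(nrm_isometry_ip nU) UW.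
Qed.

End PolarDecomposition.

Theorem theorem2p3 (R : realType) (H : hilbertType R) (T U : H -> H)
    (f : R -> R) :
  invertible_op T ->
  polar_decomposition T U (abs_op T) ->
  arithmetic_representing f \/ (representing_function f /\ binormal T) ->
  let M := op_mean f (adjoint U \o abs_op T \o U) (abs_op T) in
  [/\ aluthge f T = U \o M,
      polar_decomposition (aluthge f T) U M &
      abs_op (aluthge f T) = M].
Proof.
move=> iT pT cases.
have [P [Pi [U' [W [m [K [[UE PE bU bW] [sP [m0 hm] [K0 hK]] [bPi PPi PiP]
  [UW WU ipW]]]]]]]] := invertible_polar_data iT pT.
have [TE _ piU _] := pT.
have bP : bdd P by exists K.
have ipU u v : ip (U' u) v = ip u (W v) by rewrite ipC -ipW ipC.
have f0 : forall t, 0 < t -> 0 < f t.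
  by case: cases => [/arithmetic_representing_gt0|[[]]].
have fc : forall t, 0 < t -> {for t, continuous f}.
  by case: cases => [/arithmetic_representing_continuous|[[_ []]]].
have cases' : arithmetic_representing f \/
    (forall v, P (U' (P (W v))) = U' (P (W (P v)))).
  case: cases => [|[_ bin]]; [by left|right => v].
  (* Binormality is translated by computing the absolute value of [adjoint T] as [U P W]. *)
  have aT : adjoint T = P \o W.
    rewrite TE UE PE; apply: (@adjointE _ _ (U' \o P) (P \o W)); first exact: bdd_comp.
    by move=> x y /=; rewrite ipU sP.
  have aaT : adjoint (adjoint T) = U' \o P.
    rewrite aT; apply: (@adjointE _ _ (P \o W) (U' \o P)); first exact: bdd_comp.
    by move=> x y /=; rewrite sP ipW.
  have aE : abs_op (adjoint T) = U' \o P \o W.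
    rewrite /abs_op aaT aT.
    apply: (@sqrt_opE _ _ ((U' \o P) \o (P \o W)) (U' \o P \o W)).
    - by move=> x y /=; rewrite ipU sP ipW.
    - move=> x /=; rewrite ipU; apply: le_trans (hm _).
      by rewrite mulr_ge0 ?ip_ge0 // ltW.
    - exact: bdd_comp (bdd_comp bU bP) bW.
    - by move=> v' /=; rewrite WU.
  by have := congr1 (fun g => g v) bin; rewrite aE PE.
have [M [ME [bM sM] pM kM hM]] := aluthge_mean_ex sP m0 hm K0 hK bPi PPi PiP UW WU ipW f0 fc cases'.
have aU : adjoint U = W by rewrite UE; apply: adjointE.
move=> M'; have -> : M' = M by rewrite /M' aU PE UE -ME.
have aluE : aluthge f T = U \o M.
  have [E rE] := spectral_resolution_ex sP bP.
  pose Q := [set D : H -> H | is_aluthge f T D].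
  have hex : exists D, Q D.
    exists (U \o M), U, E; split => //; first by rewrite PE.
    by rewrite UE; apply: hM.
  (* The chosen unitary factor is [U] because [P] is onto; for the chosen resolution, uniqueness of
     the double integral suffices. *)
  have [U1 [E1 [[T1 _ _ _] rE1 iE1]]] : Q (aluthge f T) := xgetPex op0 hex.
  have U1E : U1 = U.
    apply/funext => v; rewrite -(PPi v) -PE.
    by have := congr1 (fun g => g (Pi v)) T1; rewrite {1}TE.
  have [F1 FE1] := spectral_family_linear (proj1 rE1).
  rewrite U1E UE FE1 in iE1; rewrite PE FE1 in rE1.
  by rewrite UE; apply: doi_unique iE1 (hM _ rE1); exact: (proj1 rE1).
have absE : abs_op (aluthge f T) = M.
  have aD : adjoint (U \o M) = M \o W.
    rewrite UE; apply: (@adjointE _ _ (U' \o M) (M \o W)); first exact: bdd_comp.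
    by move=> x y /=; rewrite ipU sM.
  rewrite aluE /abs_op aD UE.
  apply: (@sqrt_opE _ _ ((M \o W) \o (U' \o M)) M) => // v /=.
  by rewrite WU.
split => //; split => //.
(* The kernels agree because [U] and [M] are both injective. *)
move=> x; rewrite aluE UE /=; split => h.
  have -> : x = 0 by rewrite -(WU x) h linear0.
  by rewrite [M 0]linear0 linear0.
by have -> : x = 0; [apply: kM; rewrite -(WU (M x)) h linear0|rewrite linear0].
Qed.
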